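(* Assume that $\operatorname{supp}\rho_{0,n}\le\operatorname{supp}\rho_{1,n}$ for all $n\in\mathbb N$. Then $$\underline{s}_G(\rho_0\,\|\,\rho_1)=\overline{s}_G(\rho_0\,\|\,\rho_1)=s_G(\rho_0\,\|\,\rho_1)=-S_M(\rho_0\,\|\,\rho_1).$$
   Context: Let $\mathcal H$ be a finite-dimensional complex Hilbert space, $G$ a compact group and $g\mapsto u_g$ a continuous unitary representation of $G$ on $\mathcal H$. For $n\in\mathbb N$ let $\mathcal A_n=\{A\in\mathcal B(\mathcal H^{\otimes n}):Au_g^{\otimes n}=u_g^{\otimes n}A\ \forall g\in G\}$ and $E_{\mathcal A_n}(X)=\int_G u_g^{\otimes n}Xu_g^{*\otimes n}\,dg$ (normalized Haar measure). Let $\rho_0,\rho_1$ be states on $\mathcal B(\mathcal H)$ with density matrices $\hat\rho_0,\hat\rho_1$, and let $\rho_{k,n}$ be the state on $\mathcal B(\mathcal H^{\otimes n})$ with density $\hat\rho_{k,n}:=E_{\mathcal A_n}(\hat\rho_k^{\otimes n})$, $k=0,1$; $\operatorname{supp}\rho_{k,n}$ denotes the support projection of $\hat\rho_{k,n}$. A $G$-invariant test is a sequence $\{T_n\}$ with $T_n\in\mathcal A_n$, $0\le T_n\le I$; its error probabilities are $\beta_{0,n}(T_n)=\operatorname{Tr}\hat\rho_0^{\otimes n}(I-T_n)$ and $\beta_{1,n}(T_n)=\operatorname{Tr}\hat\rho_1^{\otimes n}T_n$. Define $\underline s_G(\rho_0\|\rho_1)$, $\overline s_G(\rho_0\|\rho_1)$,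 $s_G(\rho_0\|\rho_1)$ as the infimum, over all $G$-invariant test sequences with $\lim_{n\to\infty}\beta_{0,n}(T_n)=0$, of respectively $\liminf_n\frac1n\log\beta_{1,n}(T_n)$, $\limsup_n\frac1n\log\beta_{1,n}(T_n)$, and $\lim_n\frac1n\log\beta_{1,n}(T_n)$ (the last infimum being over those sequences for which this limit exists). The relative entropy is $S(\rho\|\sigma)=\operatorname{Tr}\hat\rho(\log\hat\rho-\log\hat\sigma)$ if $\operatorname{supp}\rho\le\operatorname{supp}\sigma$ and $+\infty$ otherwise, and $S_M(\rho_0\|\rho_1):=\lim_{n\to\infty}\frac1n S(\rho_{0,n}\|\rho_{1,n})$ (this limit exists and equals $\sup_n\frac1nS(\rho_{0,n}\|\rho_{1,n})$). *)

(* Defs.v *)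
From HB Require Import structures.
From mathcomp Require Import all_boot all_order all_algebra.
From mathcomp Require Import all_classical all_reals all_analysis.
From mathcomp Require Import complex mxtens.

Set Implicit Arguments.
Unset Strict Implicit.
Unset Printing Implicit Defensive.

Import Order.TTheory GRing.Theory Num.Theory.
Import numFieldTopology.Exports numFieldNormedType.Exports.
Local Open Scope classical_set_scope.
Local Open Scope ring_scope.

Section QHT.
Variable R : realType.
Local Notation C := (R[i]).

Definition compact_group (G : ptopologicalType) (mul : G -> G -> G)
    (inv : G -> G) (one : G) : Prop :=
  [/\ associative mul, left_id one mul & left_inverse one inv mul] /\
  [/\ continuous (fun p : G * G => mul p.1 p.2), continuous inv,
      hausdorff_space G & compact [set: G]].

Definition borel (G : ptopologicalType) := g_sigma_algebraType (@open G).

Definition normalized_haar (G : ptopologicalType) (mul : G -> G -> G)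
    (mu : {measure set (borel G) -> \bar R}) : Prop :=
  mu setT = 1%E /\
  forall (g : G) (A : set (borel G)), measurable A ->
    mu ((mul g) @` A) = mu A.

Definition cintegral (G : ptopologicalType)
    (mu : {measure set (borel G) -> \bar R}) (f : G -> C) : C :=
  Complex (Rintegral mu setT (fun g => complex.Re (f g)))
          (Rintegral mu setT (fun g => complex.Im (f g))).

Definition adj m n (A : 'M[C]_(m, n)) : 'M[C]_(n, m) := (map_mx (@Num.Def.conjC C) A)^T.

Definition unitary m (U : 'M[C]_m) : Prop := U *m adj U = 1%:M.

Definition psd m (A : 'M[C]_m) : Prop :=
  adj A = A /\ forall v : 'rV[C]_m, 0 <= (v *m A *m adj v) 0 0.

Definition loewner_le m (A B : 'M[C]_m) : Prop := psd (B - A).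

Definition density m (A : 'M[C]_m) : Prop := psd A /\ \tr A = 1.

Definition tpow d (A : 'M[C]_d) (n : nat) : 'M[C]_(d ^ n) := ntensmx A n.

(* functional calculus f(A) for a Hermitian (normal) matrix A, through the
   spectral decomposition A = P^-1 diag(sp) P of mathcomp's spectral.v *)
Definition mx_fun m (f : R -> R) (A : 'M[C]_m) : 'M[C]_m :=
  invmx (spectralmx A)
  *m diag_mx (map_mx (fun z : C => real_complex R (f (complex.Re z))) (spectral_diag A))
  *m spectralmx A.

Definition supp m (A : 'M[C]_m) : 'M[C]_m :=
  mx_fun (fun x => if x == 0 then 0 else 1) A.

(* matrix logarithm on the support (log 0 := 0, i.e. log restricted to the support) *)
Definition mlog m (A : 'M[C]_m) : 'M[C]_m :=
  mx_fun (fun x => if 0 < x then ln x else 0) A.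

Definition relent m (rho sigma : 'M[C]_m) : \bar R :=
  if `[< loewner_le (supp rho) (supp sigma) >] then
    (complex.Re (\tr (rho *m (mlog rho - mlog sigma))))%:E
  else +oo%E.

Definition elog (x : R) : \bar R := if 0 < x then (ln x)%:E else -oo%E.

Section Setting.
Variables (G : ptopologicalType) (mul : G -> G -> G) (inv : G -> G) (one : G).
Variable (mu : {measure set (borel G) -> \bar R}).
Variables (d : nat) (u : G -> 'M[C]_d).

Definition unitary_rep : Prop :=
  [/\ forall g h, u (mul g h) = u g *m u h,
      u one = 1%:M,
      forall g, unitary (u g),
      forall i j, continuous ((fun g => complex.Re (u g i j)) : G -> R)
    & forall i j, continuous ((fun g => complex.Im (u g i j)) : G -> R)].

Definition in_An n (A : 'M[C]_(d ^ n)) : Prop :=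
  forall g, A *m tpow (u g) n = tpow (u g) n *m A.

Definition EA n (X : 'M[C]_(d ^ n)) : 'M[C]_(d ^ n) :=
  \matrix_(i, j) cintegral mu
     (fun g => (tpow (u g) n *m X *m adj (tpow (u g) n)) i j).

Definition rho_n (rho : 'M[C]_d) n : 'M[C]_(d ^ n) := EA (tpow rho n).

Definition ginv_test (T : forall n, 'M[C]_(d ^ n)) : Prop :=
  forall n, in_An (T n) /\ loewner_le 0 (T n) /\ loewner_le (T n) 1%:M.

Variables (rho0 rho1 : 'M[C]_d).

Definition beta0 n (Tn : 'M[C]_(d ^ n)) : R :=
  complex.Re (\tr (tpow rho0 n *m (1%:M - Tn))).
Definition beta1 n (Tn : 'M[C]_(d ^ n)) : R :=
  complex.Re (\tr (tpow rho1 n *m Tn)).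

Definition rate (T : forall n, 'M[C]_(d ^ n)) (n : nat) : \bar R :=
  (((n%:R)^-1)%:E * elog (beta1 (T n)))%E.

Definition admissible (T : forall n, 'M[C]_(d ^ n)) : Prop :=
  ginv_test T /\ (fun n => beta0 (T n)) @ \oo --> (0 : R).

Definition s_lower : \bar R :=
  ereal_inf [set x | exists T, admissible T /\ x = limn_einf (rate T)].
Definition s_upper : \bar R :=
  ereal_inf [set x | exists T, admissible T /\ x = limn_esup (rate T)].
Definition s_lim : \bar R :=
  ereal_inf [set x | exists T, admissible T /\ rate T @ \oo --> x].

Definition S_M : \bar R :=
  limn (fun n => (((n%:R)^-1)%:E * relent (rho_n rho0 n) (rho_n rho1 n))%E).

End Setting.
End QHT.

(* Main.v *)
Require Import Defs.
From HB Require Import structures.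
From mathcomp Require Import all_boot all_order all_algebra.
From mathcomp Require Import all_classical all_reals all_analysis.
From mathcomp Require Import measurable_realfun complex mxtens ring lra.

Set Implicit Arguments.
Unset Strict Implicit.
Unset Printing Implicit Defensive.

Import Order.TTheory GRing.Theory Num.Theory Normc.
Import numFieldTopology.Exports numFieldNormedType.Exports.
Local Open Scope classical_set_scope.
Local Open Scope ring_scope.

(** Write [D n] for the relative entropy of the averaged [n]-fold states.

    Converse: an invariant test sees only the averaged states. Expanding it in
    their two eigenbases (Nussbaum and Szkola) compares its errors with those of
    a classical pair of distributions with the same relative entropy, so
    vanishing first error forces the second error above [exp (- n (s + e))] for
    all large [n] such that [D n <= n s].

    Direct part: fix a block length [m]. On [k] blocks let [P] and [Q] be the
    spectral projections of the tensor powers of the averaged states on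
    [eigenvalue >= c^k] and [eigenvalue <= t^k]. The projection onto the range
    of [Q P] is invariant under independent group actions on the blocks, has
    rank at most that of [P], and by Chernoff bounds for the two eigenvalue
    distributions has first error exponentially small and second error at most
    [exp (- k b)] for any [b < D m]. So every rate below [sup D m / m] is
    achieved, and the converse applied to these tests shows that [D n / n]
    converges to that supremum. *)

(** * Hermitian matrices *)

Section Adjoint.
Variable R : realType.
Local Notation C := R[i].

Lemma adjE m n (A : 'M[C]_(m, n)) i j : adj A i j = Num.conj (A j i).
Proof. by rewrite !mxE. Qed.

Lemma adjK m n (A : 'M[C]_(m, n)) : adj (adj A) = A.
Proof. by apply/matrixP => i j; rewrite !adjE conjCK. Qed.

Lemma adjM m n p (A : 'M[C]_(m, n)) (B : 'M[C]_(n, p)) :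
  adj (A *m B) = adj B *m adj A.
Proof. by rewrite /adj map_mxM trmx_mul. Qed.

Lemma adjD m n (A B : 'M[C]_(m, n)) : adj (A + B) = adj A + adj B.
Proof. by rewrite /adj map_mxD linearD. Qed.

Lemma adjB m n (A B : 'M[C]_(m, n)) : adj (A - B) = adj A - adj B.
Proof. by rewrite /adj map_mxB linearB. Qed.

Lemma adj_mx1 n : adj (1%:M : 'M[C]_n) = 1%:M.
Proof. by rewrite /adj map_mx1 trmx1. Qed.

Lemma adj_mx0 m n : adj (0 : 'M[C]_(m, n)) = 0.
Proof. by rewrite /adj map_mx0 trmx0. Qed.

Lemma adj_mxZ m n (c : R) (A : 'M[C]_(m, n)) : adj (c%:C%C *: A) = c%:C%C *: adj A.
Proof.
apply/matrixP => i j; rewrite adjE !mxE rmorphM; congr (_ * _).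
exact: conjc_real.
Qed.

Lemma hermitian_absorbC m (A B : 'M[C]_m) :
  adj A = A -> adj B = B -> A *m B = B -> B *m A = B.
Proof. by move=> Aherm Bherm AB; rewrite -[LHS]adjK adjM Aherm Bherm AB. Qed.

Lemma unitaryV m (U : 'M[C]_m) : unitary U -> adj U *m U = 1%:M.
Proof. exact: mulmx1C. Qed.

Lemma adj_unitary m (U : 'M[C]_m) : unitary U -> unitary (adj U).
Proof. by move=> /unitaryV UV; rewrite /unitary adjK. Qed.

Lemma unitaryM m (U V : 'M[C]_m) : unitary U -> unitary V -> unitary (U *m V).
Proof. by move=> uU uV; rewrite /unitary adjM mulmxA -(mulmxA U) uV mulmx1. Qed.

Lemma mulmx_unitaryK m n (U : 'M[C]_m) (A : 'M[C]_(n, m)) :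
  unitary U -> A *m U *m adj U = A.
Proof. by move=> uU; rewrite -mulmxA uU mulmx1. Qed.

Lemma mulmx_unitaryVK m n (U : 'M[C]_m) (A : 'M[C]_(n, m)) :
  unitary U -> A *m adj U *m U = A.
Proof. by move=> uU; rewrite -mulmxA unitaryV // mulmx1. Qed.

Lemma mul_conj_normc (z : C) : z * Num.conj z = (normc z ^+ 2)%:C%C.
Proof. by rewrite -normCK rmorphXn. Qed.

Lemma normc_conj (z : C) : normc (Num.conj z) = normc z.
Proof. by case: z => a b; rewrite /= sqrrN. Qed.

Lemma sqr_normcD_le (z w : C) : normc (z + w) ^+ 2 <= 2 * (normc z ^+ 2 + normc w ^+ 2).
Proof.
have normc_ge0 (v : C) : 0 <= normc v by case: v => a b; apply: sqrtr_ge0.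
have := le_normcD z w; have := normc_ge0 (z + w).
have := sqr_ge0 (normc z - normc w); nra.
Qed.

Lemma diag_mul_adj m n (A : 'M[C]_(m, n)) i :
  (A *m adj A) i i = (\sum_j normc (A i j) ^+ 2)%:C%C.
Proof. by rewrite mxE rmorph_sum; apply: eq_bigr => j _; rewrite adjE mul_conj_normc. Qed.

Lemma mul_adj_eq0 m n (A : 'M[C]_(m, n)) : A *m adj A = 0 -> A = 0.
Proof.
move=> AA0; apply/matrixP => i j; rewrite mxE; apply: eq0_normc.
have : \sum_j normc (A i j) ^+ 2 = 0.
  by apply: (@complexI R); rewrite -diag_mul_adj AA0 mxE.
move/eqP; rewrite psumr_eq0 => [/allP/(_ j)|k _]; last exact: sqr_ge0.
by rewrite mem_index_enum sqrf_eq0 => /(_ isT)/eqP.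
Qed.

Lemma unitary_sum_normc m (U : 'M[C]_m) i : unitary U -> \sum_j normc (U i j) ^+ 2 = 1.
Proof. by move=> uU; apply: (@complexI R); rewrite -diag_mul_adj uU mxE eqxx. Qed.

Lemma mxtrace_conj_comm m (V A T : 'M[C]_m) : unitary V -> comm_mx T V ->
  \tr (V *m A *m adj V *m T) = \tr (A *m T).
Proof.
move=> uV TV; rewrite -!mulmxA mxtrace_mulC -!mulmxA TV (mulmxA (adj V)).
by rewrite (unitaryV uV) mul1mx.
Qed.

Definition retr m (A : 'M[C]_m) : R := complex.Re (\tr A).

Lemma retrD m (A B : 'M[C]_m) : retr (A + B) = retr A + retr B.
Proof. by rewrite /retr mxtraceD raddfD. Qed.

Lemma retrB m (A B : 'M[C]_m) : retr (A - B) = retr A - retr B.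
Proof. by rewrite /retr raddfB raddfB. Qed.

Lemma retrZ m (c : R) (A : 'M[C]_m) : retr (c%:C%C *: A) = c * retr A.
Proof. by rewrite /retr mxtraceZ; case: (\tr A) => a b /=; rewrite mul0r subr0. Qed.

Lemma retr_mulC m n (A : 'M[C]_(m, n)) (B : 'M[C]_(n, m)) :
  retr (A *m B) = retr (B *m A).
Proof. by rewrite /retr mxtrace_mulC. Qed.

Lemma retr_mul_adj_ge0 m n (A : 'M[C]_(m, n)) : 0 <= retr (A *m adj A).
Proof.
rewrite /retr /mxtrace raddf_sum sumr_ge0 // => i _.
by rewrite diag_mul_adj /= sumr_ge0 // => j _; apply: sqr_ge0.
Qed.

End Adjoint.

Section SpectralForm.
Variable R : realType.
Local Notation C := R[i].
Variable m : nat.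
Implicit Types (U V A X : 'M[C]_m) (p q : 'I_m -> R).

Definition rdiag p : 'M[C]_m := diag_mx (\row_i (p i)%:C%C).

Definition spec U p : 'M[C]_m := adj U *m rdiag p *m U.

Lemma rdiagE p i j : rdiag p i j = ((p i)%:C%C *+ (i == j)).
Proof. by rewrite !mxE; case: eqP => // ->. Qed.

Lemma mul_rdiag_mx n p (A : 'M[C]_(m, n)) i j : (rdiag p *m A) i j = (p i)%:C%C * A i j.
Proof. by rewrite /rdiag mul_diag_mx !mxE. Qed.

Lemma mul_mx_rdiag n p (A : 'M[C]_(n, m)) i j : (A *m rdiag p) i j = A i j * (p j)%:C%C.
Proof. by rewrite /rdiag mul_mx_diag !mxE. Qed.

Lemma adj_rdiag p : adj (rdiag p) = rdiag p.
Proof.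
apply/matrixP => i j; rewrite adjE !rdiagE eq_sym; case: eqP => [->|_] /=.
  by rewrite !mulr1n; apply: conjc_real.
by rewrite !mulr0n rmorph0.
Qed.

Lemma mul_rdiag p q : rdiag p *m rdiag q = rdiag (fun i => p i * q i).
Proof. by apply/matrixP => i j; rewrite mul_rdiag_mx !rdiagE mulrnAr -rmorphM. Qed.

Lemma eq_spec U p q : p =1 q -> spec U p = spec U q.
Proof. by move=> /funext ->. Qed.

Lemma adj_spec U p : adj (spec U p) = spec U p.
Proof. by rewrite /spec !adjM adjK adj_rdiag mulmxA. Qed.

Lemma mul_spec U p q : unitary U ->
  spec U p *m spec U q = spec U (fun i => p i * q i).
Proof.
by move=> uU; rewrite /spec !mulmxA (mulmx_unitaryK _ uU) -(mulmxA _ (rdiag p)) mul_rdiag.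
Qed.

Lemma spec_cst U (c : R) : unitary U -> spec U (fun=> c) = c%:C%C *: 1%:M.
Proof.
move=> uU; rewrite /spec; have -> : rdiag (fun=> c) = c%:C%C *: 1%:M.
  by apply/matrixP => i j; rewrite rdiagE !mxE mulr_natr.
by rewrite -scalemxAr -scalemxAl mulmx1 unitaryV.
Qed.

Lemma specB U p q : spec U (fun i => p i - q i) = spec U p - spec U q.
Proof.
rewrite /spec -mulmxBl -mulmxBr; congr (_ *m _ *m _).
by apply/matrixP => i j; rewrite rdiagE [RHS]mxE [(- rdiag q) i j]mxE !rdiagE rmorphB mulrnBl.
Qed.

Lemma diag_conj_spec n (B : 'M[C]_(n, m)) U p i :
  (B *m spec U p *m adj B) i i = (\sum_k p k * normc ((B *m adj U) i k) ^+ 2)%:C%C.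
Proof.
have -> : B *m spec U p *m adj B = B *m adj U *m rdiag p *m adj (B *m adj U).
  by rewrite adjM adjK /spec !mulmxA.
rewrite mxE rmorph_sum; apply: eq_bigr => k _.
by rewrite mul_mx_rdiag adjE mulrAC mul_conj_normc mulrC -rmorphM.
Qed.

Lemma diag_conj_spec_self U p i : unitary U -> (U *m spec U p *m adj U) i i = (p i)%:C%C.
Proof. by move=> uU; rewrite /spec !mulmxA uU mul1mx mulmx_unitaryK // rdiagE eqxx. Qed.

Lemma retr_spec U p : unitary U -> retr (spec U p) = \sum_i p i.
Proof.
move=> uU; rewrite /retr /spec mxtrace_mulC mulmxA uU mul1mx mxtrace_diag.
by rewrite raddf_sum; apply: eq_bigr => i _; rewrite mxE.
Qed.

Lemma retr_mul_spec U p A :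
  retr (A *m spec U p) = \sum_i p i * complex.Re ((U *m A *m adj U) i i).
Proof.
rewrite /spec !mulmxA retr_mulC !mulmxA /retr /mxtrace raddf_sum.
apply: eq_bigr => i _; rewrite /= mul_mx_rdiag mulrC.
by case: ((U *m A *m adj U) i i) => a b /=; rewrite mul0r subr0.
Qed.

(* Conjugating by the two eigenbases, [X] intertwines iff its matrix vanishes
   between distinct eigenvalues, a condition that [f] preserves. *)
Lemma spec_intertwine (f : R -> R) U p V q X : unitary U -> unitary V ->
  spec U p *m X = X *m spec V q -> spec U (f \o p) *m X = X *m spec V (f \o q).
Proof.
move=> uU uV; have [Y XE] : exists Y, X = adj U *m Y *m V.
  exists (U *m X *m adj V).
  by rewrite !mulmxA (unitaryV uU) mul1mx (mulmx_unitaryVK _ uV).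
have specX p' : spec U p' *m X = adj U *m (rdiag p' *m Y) *m V.
  by rewrite XE /spec !mulmxA (mulmx_unitaryK _ uU).
have Xspec q' : X *m spec V q' = adj U *m (Y *m rdiag q') *m V.
  by rewrite XE /spec !mulmxA (mulmx_unitaryK _ uV).
rewrite !specX !Xspec => XpqE.
have pY : rdiag p *m Y = Y *m rdiag q.
  have := congr1 (fun M => U *m M *m adj V) XpqE.
  by rewrite !mulmxA uU !mul1mx !(mulmx_unitaryK _ uV).
apply: (congr1 (fun M => adj U *m M *m V)).
apply/matrixP => i j; move/matrixP/(_ i j): pY.
rewrite !mul_mx_rdiag !mul_rdiag_mx /= => pYij.
have [<-|p_neq_q] := eqVneq (p i) (q j); first by rewrite mulrC.
suff -> : Y i j = 0 by rewrite mulr0 mul0r.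
apply/eqP; move/eqP: pYij; rewrite mulrC -subr_eq0 -mulrBr -rmorphB mulf_eq0.
by case/orP=> // /eqP /(@complexI R)/eqP; rewrite subr_eq0 (negPf p_neq_q).
Qed.

Lemma mx_fun_spectralmx A : adj A = A ->
  let p i := complex.Re (spectral_diag A 0 i) in
  [/\ unitary (spectralmx A), A = spec (spectralmx A) p &
      forall f, mx_fun f A = spec (spectralmx A) (f \o p)].
Proof.
move=> Aherm p.
have Ahermsym : A \is hermsymmx.
  by apply/is_hermitianmxP; rewrite expr0 scale1r -{1}Aherm /adj map_trmx.
have spectralV : invmx (spectralmx A) = adj (spectralmx A).
  by rewrite (invmx_unitary (spectral_unitarymx A)) /adj map_trmx.
split.
- by have /unitarymxP := spectral_unitarymx A; rewrite /unitary /adj map_trmx.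
- rewrite /spec -spectralV {1}(orthomx_spectralP (hermitian_normalmx Ahermsym)).
  congr (_ *m _ *m _); rewrite /rdiag; congr diag_mx; apply/rowP => i; rewrite mxE.
  by rewrite RRe_real //; have /mxOverP/(_ 0 i) := hermitian_spectral_diag_real Ahermsym.
- move=> f; rewrite /mx_fun /spec -spectralV; congr (_ *m _ *m _).
  by rewrite /rdiag; congr diag_mx; apply/rowP => i; rewrite !mxE.
Qed.

Lemma hermitian_spec A : adj A = A -> exists U p, unitary U /\ A = spec U p.
Proof.
move=> /mx_fun_spectralmx[uA AE _].
by exists (spectralmx A); eexists; split; last exact: AE.
Qed.

Lemma mx_fun_spec (f : R -> R) U p : unitary U -> mx_fun f (spec U p) = spec U (f \o p).
Proof.
move=> uU; have [uS specE ->] := mx_fun_spectralmx (adj_spec U p).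
rewrite -[LHS]mulmx1 -[RHS]mul1mx; apply: spec_intertwine => //.
by rewrite mulmx1 mul1mx -specE.
Qed.

End SpectralForm.

Section FunctionalCalculus.
Variable R : realType.
Local Notation C := R[i].
Variable m : nat.
Implicit Types (A P Q X : 'M[C]_m) (f g : R -> R) (b : pred R).

Lemma mx_fun_id A : adj A = A -> mx_fun id A = A.
Proof. by move=> /hermitian_spec[U [p [uU ->]]]; exact: mx_fun_spec. Qed.

Lemma mx_fun_cst (c : R) A : adj A = A -> mx_fun (fun=> c) A = c%:C%C *: 1%:M.
Proof.
by move=> /hermitian_spec[U [p [uU ->]]]; rewrite (mx_fun_spec _ _ uU) -(spec_cst c uU).
Qed.

Lemma adj_mx_fun f A : adj A = A -> adj (mx_fun f A) = mx_fun f A.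
Proof.
by move=> /hermitian_spec[U [p [uU ->]]]; rewrite (mx_fun_spec _ _ uU); exact: adj_spec.
Qed.

Lemma mx_funM f g A : adj A = A ->
  mx_fun f A *m mx_fun g A = mx_fun (fun x => f x * g x) A.
Proof.
by move=> /hermitian_spec[U [p [uU ->]]]; rewrite !(mx_fun_spec _ _ uU); exact: mul_spec.
Qed.

Lemma mx_funB f g A : adj A = A ->
  mx_fun (fun x => f x - g x) A = mx_fun f A - mx_fun g A.
Proof.
by move=> /hermitian_spec[U [p [uU ->]]]; rewrite !(mx_fun_spec _ _ uU); exact: specB.
Qed.

Lemma comm_mx_fun f A X : adj A = A -> comm_mx X A -> comm_mx X (mx_fun f A).
Proof.
move=> /hermitian_spec[U [p [uU ->]]]; rewrite (mx_fun_spec _ _ uU) => XA.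
by apply/esym/(spec_intertwine f uU uU)/esym.
Qed.

Definition projection A := adj A = A /\ A *m A = A.

Lemma projectionB P Q : projection P -> projection Q -> Q *m P = P -> projection (Q - P).
Proof.
move=> [Pherm PP] [Qherm QQ] QP; split; first by rewrite adjB Pherm Qherm.
by rewrite mulmxBr !mulmxBl QQ QP (hermitian_absorbC Qherm Pherm QP) PP subrr subr0.
Qed.

Lemma projection1 : projection (1%:M : 'M[C]_m).
Proof. by split; [exact: adj_mx1|exact: mulmx1]. Qed.

Lemma projectionC P : projection P -> projection (1%:M - P).
Proof. by move=> Pproj; apply: projectionB => //; [exact: projection1|exact: mul1mx]. Qed.

Definition spectral_proj b A := mx_fun (fun x => (b x)%:R) A.

Lemma projection_spectral_proj b A : adj A = A -> projection (spectral_proj b A).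
Proof.
move=> Aherm; split; first exact: adj_mx_fun.
rewrite /spectral_proj (mx_funM _ _ Aherm); congr mx_fun; apply/funext => x.
by rewrite -natrM mulnb andbb.
Qed.

Lemma spectral_projC b A : adj A = A ->
  1%:M - spectral_proj b A = spectral_proj (fun x => ~~ b x) A.
Proof.
move=> Aherm; have -> : 1%:M = mx_fun (fun=> 1) A by rewrite (mx_fun_cst 1 Aherm) scale1r.
rewrite /spectral_proj -(mx_funB _ _ Aherm); congr mx_fun; apply/funext => x /=.
by case: (b x); rewrite ?subrr ?subr0.
Qed.

Lemma supp_spectral_proj A : supp A = spectral_proj (fun x => x != 0) A.
Proof. by congr mx_fun; apply/funext => x; case: eqP. Qed.

Lemma projection_supp A : adj A = A -> projection (supp A).
Proof. by move=> Aherm; rewrite supp_spectral_proj; apply: projection_spectral_proj. Qed.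

Lemma supp_mul A : adj A = A -> supp A *m A = A.
Proof.
move=> Aherm; rewrite -{2 3}(mx_fun_id Aherm) (mx_funM _ _ Aherm); congr mx_fun.
by apply/funext => x; case: eqP => [->|_]; rewrite ?mulr0 ?mul1r.
Qed.

Lemma hermitian_pseudo_inverse A : adj A = A ->
  exists B : 'M[C]_m, [/\ adj B = B, A *m B = supp A & B *m supp A = B].
Proof.
(* [0^-1 = 0] makes the spectral inverse vanish on the kernel of [A]. *)
move=> Aherm; exists (mx_fun (fun x => x^-1) A); split; first exact: adj_mx_fun.
- rewrite -{1}(mx_fun_id Aherm) (mx_funM _ _ Aherm); congr mx_fun.
  by apply/funext => x; case: eqP => [->|/eqP x0]; rewrite ?mul0r ?divff.
- rewrite (mx_funM _ _ Aherm); congr mx_fun.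
  by apply/funext => x; case: eqP => [->|_]; rewrite ?mulr0 ?invr0 ?mulr1.
Qed.

End FunctionalCalculus.

Section Positivity.
Variable R : realType.
Local Notation C := R[i].
Variable m : nat.
Implicit Types (U A B P T : 'M[C]_m) (p : 'I_m -> R).

Lemma psd_spec U p : (forall i, 0 <= p i) -> psd (spec U p).
Proof.
move=> p_ge0; split=> [|v]; first exact: adj_spec.
by rewrite diag_conj_spec ler0c sumr_ge0 // => k _; rewrite mulr_ge0 ?sqr_ge0.
Qed.

Lemma row_conj_diag n A (B : 'M[C]_(n, m)) i :
  (row i B *m A *m adj (row i B)) 0 0 = (B *m A *m adj B) i i.
Proof. by rewrite -row_mul !mxE; apply: eq_bigr => k _; rewrite !adjE !mxE. Qed.

Lemma psd_diag_conj_ge0 n A (B : 'M[C]_(n, m)) i :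
  psd A -> 0 <= complex.Re ((B *m A *m adj B) i i).
Proof.
move=> [_ /(_ (row i B))]; rewrite row_conj_diag.
by rewrite lecE /= => /andP[].
Qed.

Lemma psd_spec_ge0 U p : unitary U -> psd (spec U p) -> forall i, 0 <= p i.
Proof.
by move=> uU Upsd i; have := psd_diag_conj_ge0 U i Upsd; rewrite diag_conj_spec_self.
Qed.

Lemma psdP A : psd A -> exists U p, [/\ unitary U, A = spec U p & forall i, 0 <= p i].
Proof.
move=> Apsd; have [U [p [uU AE]]] := hermitian_spec Apsd.1.
by exists U, p; split=> //; apply: psd_spec_ge0 uU _; rewrite -AE.
Qed.

Lemma psd_mul_adj n (X : 'M[C]_(m, n)) : psd (X *m adj X).
Proof.
split=> [|v]; first by rewrite adjM adjK.
rewrite -!mulmxA (mulmxA v) -adjM diag_mul_adj ler0c sumr_ge0 // => j _.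
exact: sqr_ge0.
Qed.

Lemma psd_sqrt A : psd A -> exists X : 'M[C]_m, A = X *m adj X.
Proof.
move=> Apsd; exists (mx_fun Num.sqrt A); have [U [p [uU -> p_ge0]]] := psdP Apsd.
rewrite (mx_fun_spec _ _ uU) adj_spec (mul_spec _ _ uU).
by apply: eq_spec => i; rewrite /= -expr2 sqr_sqrtr.
Qed.

Lemma retr_mul_ge0 A B : psd A -> psd B -> 0 <= retr (A *m B).
Proof.
move=> /psd_sqrt[X ->] /psd_sqrt[Y ->]; rewrite mulmxA retr_mulC.
suff -> : adj Y *m (X *m adj X *m Y) = (adj Y *m X) *m adj (adj Y *m X).
  exact: retr_mul_adj_ge0.
by rewrite adjM adjK !mulmxA.
Qed.

Lemma retr_ge0 A : psd A -> 0 <= retr A.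
Proof.
move=> Apsd; rewrite -[A]mulmx1; apply: retr_mul_ge0; first exact: Apsd.
by have := psd_mul_adj (1%:M : 'M[C]_m); rewrite adj_mx1 mulmx1.
Qed.

Lemma psdD A B : psd A -> psd B -> psd (A + B).
Proof.
move=> [Aherm Apos] [Bherm Bpos]; split=> [|v]; first by rewrite adjD Aherm Bherm.
by rewrite mulmxDr mulmxDl mxE addr_ge0.
Qed.

Lemma psdZ (c : R) A : 0 <= c -> psd A -> psd (c%:C%C *: A).
Proof.
move=> c_ge0 [Aherm Apos]; split=> [|v]; first by rewrite adj_mxZ Aherm.
by rewrite -scalemxAr -scalemxAl mxE mulr_ge0 // ler0c.
Qed.

Lemma projection_psd P : projection P -> psd P.
Proof. by move=> [Pherm PP]; rewrite -PP -{2}Pherm; apply: psd_mul_adj. Qed.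

Definition effect T := psd T /\ psd (1%:M - T).

Lemma effectC T : effect T -> effect (1%:M - T).
Proof.
by move=> [T_ge0 T_le1]; split; [exact: T_le1|rewrite opprB addrC subrK; exact: T_ge0].
Qed.

Lemma projection_effect P : projection P -> effect P.
Proof. by move=> Pproj; split; apply: projection_psd => //; apply: projectionC. Qed.

Lemma effect_mix (c : R) T : effect T -> 0 <= c <= 1 ->
  effect (1%:M - (1 - c)%:C%C *: (1%:M - T)).
Proof.
move=> [T_ge0 T_le1] /andP[c_ge0 c_le1]; apply: effectC; split.
  by apply: psdZ => //; rewrite subr_ge0.
have -> : 1%:M - (1 - c)%:C%C *: (1%:M - T) = T + c%:C%C *: (1%:M - T).
  by rewrite rmorphB scalerBl scale1r !opprB addrA addrC addrA subrK.
by apply: psdD; [exact: T_ge0|exact: psdZ].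
Qed.

Lemma loewner_effectP T : loewner_le 0 T /\ loewner_le T 1%:M <-> effect T.
Proof. by rewrite /loewner_le subr0. Qed.

Lemma effect_sub_sqr T : effect T -> psd (T - T *m T).
Proof.
move=> [/psdP[U [p [uU -> p_ge0]]]]; rewrite -(scale1r 1%:M) -(spec_cst 1 uU) -specB.
move=> /(psd_spec_ge0 uU) p_le1; rewrite (mul_spec _ _ uU) -specB; apply: psd_spec => i.
have := p_le1 i; have := p_ge0 i; nra.
Qed.

End Positivity.

(** * Relative entropy and the converse bound *)

Section KullbackLeibler.
Variables (R : realType) (I : finType).
Implicit Types P Q : I -> R.

Definition kl P Q : R := \sum_i P i * (ln (P i) - ln (Q i)).

Lemma sub_le_mul_ln_sub (p q : R) : 0 <= p -> 0 <= q -> (q = 0 -> p = 0) ->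
  p - q <= p * (ln p - ln q).
Proof.
rewrite le_eqVlt => /predU1P[<- q_ge0 _|p_gt0]; first by rewrite mul0r sub0r oppr_le0.
rewrite le_eqVlt => /predU1P[<- /(_ erefl) p0|q_gt0 _]; first by rewrite p0 ltxx in p_gt0.
have : ln (q / p) <= q / p - 1.
  rewrite -[X in ln X](subrKC 1); apply: le_ln1Dx.
  by rewrite ltrBrDl addrN divr_gt0.
rewrite ln_div ?posrE // => /(ler_wpM2l (ltW p_gt0)).
have -> : p * (q / p - 1) = q - p by field; rewrite gt_eqF.
lra.
Qed.

Lemma kl_ge0 P Q : (forall i, 0 <= P i) -> (forall i, 0 <= Q i) ->
  (forall i, Q i = 0 -> P i = 0) -> \sum_i Q i = \sum_i P i -> 0 <= kl P Q.
Proof.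
move=> P_ge0 Q_ge0 PQ sumQ; have -> : 0 = \sum_i (P i - Q i) by rewrite sumrB sumQ subrr.
by apply: ler_sum => i _; apply: sub_le_mul_ln_sub => //; apply: PQ.
Qed.

Lemma sub_mul_ln_le_min (p q a : R) : 0 <= p -> 0 <= q -> (q = 0 -> p = 0) -> 0 < a ->
  p - a^-1 * (q + p * (ln p - ln q)) <= Num.min p (expR a * q).
Proof.
move=> p_ge0 q_ge0 pq a_gt0; have := sub_le_mul_ln_sub p_ge0 q_ge0 pq.
set D := p * _ => pqD; have aV_ge0 : 0 <= a^-1 by rewrite invr_ge0 ltW.
have [p_le|p_gt] := leP p (expR a * q).
  by rewrite lerBlDl lerDr mulr_ge0 // (le_trans p_ge0) // -lerBlDl.
have p_gt0 : 0 < p by apply: le_lt_trans p_gt; rewrite mulr_ge0 ?expR_ge0.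
have q_gt0 : 0 < q.
  rewrite lt_neqAle q_ge0 andbT eq_sym; apply: contraTneq p_gt0 => /pq ->.
  by rewrite ltxx.
have a_le : a <= ln p - ln q.
  rewrite -[X in X <= _](expRK a) -ln_div ?posrE // ler_ln ?posrE ?expR_gt0 ?divr_gt0 //.
  by rewrite ler_pdivlMr // ltW.
apply: (@le_trans _ _ 0); last by rewrite mulr_ge0 ?expR_ge0.
rewrite subr_le0 ler_pdivlMl // mulrC (le_trans (ler_wpM2l p_ge0 a_le)) //.
by rewrite lerDr.
Qed.

Lemma kl_le_sum_min P Q (a : R) : (forall i, 0 <= P i) -> (forall i, 0 <= Q i) ->
  (forall i, Q i = 0 -> P i = 0) -> 0 < a ->
  \sum_i P i - a^-1 * (\sum_i Q i + kl P Q) <= \sum_i Num.min (P i) (expR a * Q i).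
Proof.
move=> P_ge0 Q_ge0 PQ a_gt0; rewrite -big_split mulr_sumr -sumrB.
by apply: ler_sum => i _; apply: sub_mul_ln_le_min => //; apply: PQ.
Qed.

End KullbackLeibler.

Section Overlap.
Variable R : realType.
Local Notation C := R[i].
Variable m : nat.
Implicit Types (U V : 'M[C]_m) (p q : 'I_m -> R).

Definition overlap U V i j : R := normc ((U *m adj V) i j) ^+ 2.

Lemma overlap_ge0 U V i j : 0 <= overlap U V i j.
Proof. exact: sqr_ge0. Qed.

Lemma overlapC U V i j : overlap U V i j = overlap V U j i.
Proof. by rewrite /overlap -normc_conj -adjE adjM adjK. Qed.

Lemma sum_overlapl U V i : unitary U -> unitary V -> \sum_j overlap U V i j = 1.
Proof. by move=> uU uV; apply/unitary_sum_normc/unitaryM/adj_unitary. Qed.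

Lemma sum_overlapr U V j : unitary U -> unitary V -> \sum_i overlap U V i j = 1.
Proof.
by move=> uU uV; under eq_bigr do rewrite overlapC; exact: sum_overlapl.
Qed.

Lemma overlap_supp U p V q i j : unitary U -> unitary V ->
  loewner_le (supp (spec U p)) (supp (spec V q)) ->
  p i != 0 -> q j = 0 -> overlap U V i j = 0.
Proof.
move=> uU uV /(psd_diag_conj_ge0 V j).
rewrite /supp (mx_fun_spec _ _ uU) (mx_fun_spec _ _ uV) mulmxBr mulmxBl.
rewrite mxE [X in _ + X]mxE raddfB (diag_conj_spec_self _ _ uV) diag_conj_spec /=.
move=> supp_le pi0 qj0; move: supp_le; rewrite qj0 eqxx sub0r oppr_ge0 (bigD1 i) //=.
rewrite (negPf pi0) mul1r -/(overlap V U j i) -overlapC => supp_le.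
apply/eqP; rewrite eq_le overlap_ge0 andbT (le_trans _ supp_le) // lerDl.
by rewrite sumr_ge0 // => k _; rewrite mulr_ge0 ?sqr_ge0 //; case: eqP.
Qed.

(* The Nussbaum-Szkola distributions of [spec U p] and [spec V q]. *)
Definition ns_fst U V p (ij : 'I_m * 'I_m) : R := p ij.1 * overlap U V ij.1 ij.2.
Definition ns_snd U V q (ij : 'I_m * 'I_m) : R := q ij.2 * overlap U V ij.1 ij.2.

Lemma sum_ns_fst U V p : unitary U -> unitary V -> \sum_ij ns_fst U V p ij = \sum_i p i.
Proof.
move=> uU uV; rewrite -(pair_bigA _ (fun i j => p i * overlap U V i j)) /=.
by apply: eq_bigr => i _; rewrite -mulr_sumr sum_overlapl // mulr1.
Qed.

Lemma sum_ns_snd U V q : unitary U -> unitary V -> \sum_ij ns_snd U V q ij = \sum_j q j.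
Proof.
move=> uU uV; rewrite -(pair_bigA _ (fun i j => q j * overlap U V i j)) exchange_big /=.
by apply: eq_bigr => j _; rewrite -mulr_sumr sum_overlapr // mulr1.
Qed.

Lemma ns_dominated U p V q : unitary U -> unitary V ->
  loewner_le (supp (spec U p)) (supp (spec V q)) ->
  forall ij, ns_snd U V q ij = 0 -> ns_fst U V p ij = 0.
Proof.
move=> uU uV supp_le [i j] /eqP; rewrite /ns_fst /ns_snd mulf_eq0 /=.
case/orP => [/eqP qj0|/eqP ->]; last by rewrite mulr0.
have [->|pi0] := eqVneq (p i) 0; first by rewrite mul0r.
by rewrite (overlap_supp uU uV supp_le) // mulr0.
Qed.

End Overlap.

Section RelativeEntropy.
Variable R : realType.
Local Notation C := R[i].
Variable m : nat.
Implicit Types (U V rho sigma T : 'M[C]_m) (p q : 'I_m -> R).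

Lemma mlogE rho : mlog rho = mx_fun (@ln R) rho.
Proof. by congr mx_fun; apply/funext => x; case: ltP => // /ln0. Qed.

Lemma relentE rho sigma : loewner_le (supp rho) (supp sigma) ->
  relent rho sigma = (retr (rho *m mlog rho) - retr (rho *m mlog sigma))%:E.
Proof. by rewrite /relent; case: asboolP => // _ _; rewrite mulmxBr -retrB. Qed.

Lemma fine_relentK rho sigma : loewner_le (supp rho) (supp sigma) ->
  (fine (relent rho sigma))%:E = relent rho sigma.
Proof. by move=> /relentE ->. Qed.

Lemma retr_mlog_self U p : unitary U ->
  retr (spec U p *m mlog (spec U p)) = \sum_i p i * ln (p i).
Proof.
by move=> uU; rewrite mlogE (mx_fun_spec _ _ uU) (mul_spec _ _ uU) (retr_spec _ uU).
Qed.

Lemma relent_kl U p V q : unitary U -> unitary V ->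
  (forall i, 0 <= p i) -> (forall j, 0 <= q j) ->
  loewner_le (supp (spec U p)) (supp (spec V q)) ->
  relent (spec U p) (spec V q) = (kl (ns_fst U V p) (ns_snd U V q))%:E.
Proof.
move=> uU uV p_ge0 q_ge0 supp_le; rewrite (relentE supp_le) !mlogE.
rewrite (mx_fun_spec _ _ uU) (mx_fun_spec _ _ uV) (mul_spec _ _ uU) (retr_spec _ uU).
congr EFin; rewrite retr_mul_spec /kl.
transitivity (\sum_i \sum_j p i * overlap U V i j * (ln (p i) - ln (q j))).
  under [RHS]eq_bigr do under eq_bigr do rewrite mulrBr.
  under [RHS]eq_bigr do rewrite sumrB; rewrite sumrB; congr (_ - _).
    by apply: eq_bigr => i _; rewrite -mulr_suml -mulr_sumr sum_overlapl // mulr1.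
  rewrite exchange_big; apply: eq_bigr => j _.
  rewrite diag_conj_spec /= mulrC mulr_suml; apply: eq_bigr => i _.
  by rewrite -/(overlap V U j i) overlapC.
rewrite pair_bigA; apply: eq_bigr => -[i j] _ /=; rewrite /ns_fst /ns_snd /=.
have [->|pi0] := eqVneq (p i) 0; first by rewrite !mul0r.
have [->|w0] := eqVneq (overlap U V i j) 0; first by rewrite !mulr0 !mul0r.
have w_gt0 : 0 < overlap U V i j by rewrite lt_neqAle eq_sym w0 overlap_ge0.
have pi_gt0 : 0 < p i by rewrite lt_neqAle eq_sym pi0 p_ge0.
have qj_gt0 : 0 < q j.
  rewrite lt_neqAle q_ge0 andbT eq_sym; apply: contra_neq w0.
  exact: (overlap_supp uU uV supp_le).
by move: (overlap U V i j) w_gt0 => w w_gt0; rewrite !lnM ?posrE //; ring.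
Qed.

Lemma densityP rho : density rho -> exists U p,
  [/\ unitary U, rho = spec U p, forall i, 0 <= p i & \sum_i p i = 1].
Proof.
move=> [/psdP[U [p [uU -> p_ge0]]] tr1]; exists U, p; split=> //.
by rewrite -(retr_spec p uU) /retr tr1.
Qed.

Lemma relent_ge0 rho sigma : density rho -> density sigma ->
  loewner_le (supp rho) (supp sigma) -> 0 <= fine (relent rho sigma).
Proof.
move=> /densityP[U [p [uU -> p_ge0 p1]]] /densityP[V [q [uV -> q_ge0 q1]]] supp_le.
rewrite relent_kl //=; apply: kl_ge0.
- by move=> ij; rewrite mulr_ge0 ?overlap_ge0.
- by move=> ij; rewrite mulr_ge0 ?overlap_ge0.
- exact: ns_dominated.
- by rewrite sum_ns_fst // sum_ns_snd // p1.
Qed.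

Lemma retr_spec_sqr U p V T : unitary V -> adj T = T ->
  retr (spec U p *m (T *m T)) = \sum_i \sum_j p i * normc ((U *m T *m adj V) i j) ^+ 2.
Proof.
move=> uV Therm; rewrite retr_mulC retr_mul_spec; apply: eq_bigr => i _.
rewrite -mulr_sumr; congr (_ * _).
suff -> : U *m (T *m T) *m adj U = (U *m T *m adj V) *m adj (U *m T *m adj V).
  by rewrite diag_mul_adj.
by rewrite !adjM adjK Therm !mulmxA (mulmx_unitaryVK _ uV).
Qed.

Lemma retr_spec_sqr_le U p T : (forall i, 0 <= p i) -> effect T ->
  retr (spec U p *m (T *m T)) <= retr (spec U p *m T).
Proof.
move=> p_ge0 Teff; rewrite -subr_ge0 -retrB -mulmxBr; apply: retr_mul_ge0.
  exact: psd_spec.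
exact: effect_sub_sqr.
Qed.

(* Write [U V^* = U (1 - T) V^* + U T V^*] entrywise, and use [T^2 <= T]. *)
Lemma sum_min_ns_le_errors U p V q T (s : R) : unitary U -> unitary V ->
  (forall i, 0 <= p i) -> (forall j, 0 <= q j) -> 0 <= s -> effect T ->
  \sum_ij Num.min (ns_fst U V p ij) (s * ns_snd U V q ij) <=
  2 * (retr (spec U p *m (1%:M - T)) + s * retr (spec V q *m T)).
Proof.
move=> uU uV p_ge0 q_ge0 s_ge0 Teff; have T'eff := effectC Teff.
have errors_ge := lerD (retr_spec_sqr_le U p_ge0 T'eff)
  (ler_wpM2l s_ge0 (retr_spec_sqr_le V q_ge0 Teff)).
apply: le_trans (ler_wpM2l (ler0n _ 2) errors_ge).
rewrite (retr_spec_sqr U p uV T'eff.1.1) (retr_spec_sqr V q uU Teff.1.1).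
rewrite [X in s * X]exchange_big [X in _ + X]mulr_sumr -big_split mulr_sumr.
rewrite -(pair_bigA _ (fun i j =>
  Num.min (p i * overlap U V i j) (s * (q j * overlap U V i j)))).
apply: ler_sum => i _; rewrite mulr_sumr -big_split mulr_sumr.
apply: ler_sum => j _ /=; rewrite mulrA -minr_pMl ?overlap_ge0 //.
set c := Num.min _ _; have c_ge0 : 0 <= c by rewrite le_min p_ge0 mulr_ge0.
have -> : normc ((V *m T *m adj U) j i) ^+ 2 = normc ((U *m T *m adj V) i j) ^+ 2.
  by rewrite -normc_conj -adjE !adjM adjK Teff.1.1 !mulmxA.
have UVE : U *m adj V = U *m (1%:M - T) *m adj V + U *m T *m adj V.
  by rewrite -mulmxDl -mulmxDr subrK mulmx1.
rewrite /overlap UVE [X in normc X]mxE.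
set z := (U *m (1%:M - T) *m adj V) i j; set w := (U *m T *m adj V) i j.
apply: (le_trans (ler_wpM2l c_ge0 (sqr_normcD_le z w))).
rewrite mulrCA ler_pM2l // mulrDr mulrA.
by apply: lerD; apply: ler_wpM2r; rewrite ?sqr_ge0 // ge_min lexx ?orbT.
Qed.

Lemma relent_le_errors rho sigma T (a : R) : density rho -> density sigma ->
  loewner_le (supp rho) (supp sigma) -> effect T -> 0 < a ->
  1 - a^-1 * (1 + fine (relent rho sigma)) <=
  2 * (retr (rho *m (1%:M - T)) + expR a * retr (sigma *m T)).
Proof.
move=> /densityP[U [p [uU -> p_ge0 p1]]] /densityP[V [q [uV -> q_ge0 q1]]].
move=> supp_le Teff a_gt0.
apply: le_trans (sum_min_ns_le_errors uU uV p_ge0 q_ge0 (expR_ge0 a) Teff).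
rewrite relent_kl //= -{1}p1 -(sum_ns_fst p uU uV) -q1 -(sum_ns_snd q uU uV).
apply: kl_le_sum_min => //.
- by move=> ij; rewrite mulr_ge0 ?overlap_ge0.
- by move=> ij; rewrite mulr_ge0 ?overlap_ge0.
- exact: ns_dominated.
Qed.

Lemma second_error_ge rho sigma T (a c : R) : density rho -> density sigma ->
  loewner_le (supp rho) (supp sigma) -> effect T -> 0 < a ->
  1 + fine (relent rho sigma) <= a * (1 - c) -> retr (rho *m (1%:M - T)) <= c / 4 ->
  c / 4 * expR (- a) <= retr (sigma *m T).
Proof.
move=> rho_dens sigma_dens supp_le Teff a_gt0 relent_le err0_le.
have := relent_le_errors rho_dens sigma_dens supp_le Teff a_gt0.
have : a^-1 * (1 + fine (relent rho sigma)) <= 1 - c by rewrite ler_pdivrMl.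
rewrite expRN ler_pdivrMr ?expR_gt0 // (mulrC (retr _)); lra.
Qed.

End RelativeEntropy.

(** * A test from two spectral projections *)

Section RangeProjection.
Variable R : realType.
Local Notation C := R[i].
Variable m : nat.
Implicit Types (P Q X rho sigma : 'M[C]_m).

(* The projection onto the range of [Q P]. *)
Definition range_proj P Q := supp (Q *m P *m Q).

Section Projections.
Variables P Q : 'M[C]_m.
Hypotheses (Pproj : projection P) (Qproj : projection Q).

Let adj_compression : adj (Q *m P *m Q) = Q *m P *m Q.
Proof. by rewrite !adjM Pproj.1 Qproj.1 mulmxA. Qed.

Lemma projection_range_proj : projection (range_proj P Q).
Proof. exact: projection_supp. Qed.

Lemma comm_range_proj X : comm_mx X P -> comm_mx X Q -> comm_mx X (range_proj P Q).
Proof.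
move=> XP XQ; rewrite /range_proj supp_spectral_proj.
by apply: comm_mx_fun => //; apply: comm_mxM => //; apply: comm_mxM.
Qed.

Lemma mul_range_proj : Q *m range_proj P Q = range_proj P Q.
Proof.
have [B [_ suppE _]] := hermitian_pseudo_inverse adj_compression.
by rewrite /range_proj -suppE !mulmxA Qproj.2.
Qed.

Lemma range_proj_mul : range_proj P Q *m (Q *m P) = Q *m P.
Proof.
set T := range_proj P Q; have [Therm _] := projection_range_proj.
apply/esym/eqP; rewrite -subr_eq0 -{1}[Q *m P]mul1mx -mulmxBl; apply/eqP/mul_adj_eq0.
have -> : (1%:M - T) *m (Q *m P) *m adj ((1%:M - T) *m (Q *m P)) =
    (1%:M - T) *m (Q *m (P *m P) *m Q) *m (1%:M - T).
  by rewrite !adjM adjB adj_mx1 Pproj.1 Qproj.1 Therm !mulmxA.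
by rewrite Pproj.2 mulmxBl mul1mx supp_mul // subrr mul0mx.
Qed.

(* With [B] the pseudo-inverse of [Q P Q], the trace of [range_proj P Q] is
   that of the projection [P Q B Q P], which is below [P]. *)
Lemma retr_range_proj_le : retr (range_proj P Q) <= retr P.
Proof.
have [B [Bherm suppE Bsupp]] := hermitian_pseudo_inverse adj_compression.
pose E := P *m Q *m B *m (Q *m P).
have PE : P *m E = E by rewrite /E !mulmxA Pproj.2.
have -> : retr (range_proj P Q) = retr E.
  by rewrite /range_proj -suppE /E [RHS]retr_mulC !mulmxA -(mulmxA Q P P) Pproj.2.
have Eproj : projection E.
  split; first by rewrite /E !adjM Pproj.1 Qproj.1 Bherm !mulmxA.
  have sandwich (X Z : 'M[C]_m) :
      X *m B *m Z *m (X *m B *m Z) = X *m (B *m (Z *m X *m B)) *m Z by rewrite !mulmxA.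
  have QPPQ : Q *m P *m (P *m Q) = Q *m P *m Q by rewrite mulmxA -(mulmxA Q) Pproj.2.
  by rewrite /E sandwich QPPQ suppE Bsupp.
by rewrite -subr_ge0 -retrB; apply/retr_ge0/projection_psd/projectionB.
Qed.

Lemma range_proj_fst_error rho : psd rho -> comm_mx rho P ->
  retr (rho *m (1%:M - range_proj P Q)) <=
  retr (rho *m (1%:M - P)) + retr (rho *m (1%:M - Q)).
Proof.
move=> rho_ge0 rhoP; set T := range_proj P Q; set F := Q - T.
have Tproj := projection_range_proj.
have Fproj : projection F by apply: projectionB => //; exact: mul_range_proj.
have TQ : T *m Q = T by apply: hermitian_absorbC Qproj.1 Tproj.1 mul_range_proj.
have FP : F *m P = 0 by rewrite mulmxBl -{1}TQ -mulmxA range_proj_mul subrr.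
have PF : P *m F = 0 by rewrite -[LHS]adjK adjM Fproj.1 Pproj.1 FP adj_mx0.
have -> : 1%:M - T = F + (1%:M - Q) by rewrite [RHS]addrC addrA subrK.
rewrite (mulmxDr rho F) retrD lerD2r.
have -> : rho *m F = rho *m (1%:M - P) *m F by rewrite -mulmxA mulmxBl mul1mx PF subr0.
rewrite -subr_ge0 -retrB -{1}[_ *m (_ - P)]mulmx1 -mulmxBr.
apply: retr_mul_ge0; last exact/projection_psd/projectionC.
have P'proj := projectionC Pproj.
have -> : rho *m (1%:M - P) = (1%:M - P) *m rho *m adj (1%:M - P).
  rewrite P'proj.1; have -> : (1%:M - P) *m rho = rho *m (1%:M - P).
    by rewrite mulmxBl mulmxBr mul1mx mulmx1 rhoP.
  by rewrite -mulmxA P'proj.2.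
have [X ->] := psd_sqrt rho_ge0.
by rewrite mulmxA -mulmxA -adjM; apply: psd_mul_adj.
Qed.

Lemma range_proj_snd_error sigma (t : R) : 0 <= t -> psd (t%:C%C *: Q - sigma *m Q) ->
  retr (sigma *m range_proj P Q) <= t * retr P.
Proof.
move=> t_ge0 sigmaQ_le; have Tpsd := projection_psd projection_range_proj.
apply: le_trans (ler_wpM2l t_ge0 retr_range_proj_le).
have := retr_mul_ge0 sigmaQ_le Tpsd.
by rewrite mulmxBl -scalemxAl -mulmxA mul_range_proj retrB retrZ subr_ge0.
Qed.

End Projections.

Lemma retr_spectral_proj_ge (c : R) rho : psd rho -> 0 < c ->
  c * retr (spectral_proj (fun x => c <= x) rho) <= retr rho.
Proof.
move=> rho_ge0 c_gt0; have [U [p [uU -> p_ge0]]] := psdP rho_ge0.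
rewrite /spectral_proj (mx_fun_spec _ _ uU) !(retr_spec _ uU) mulr_sumr.
by apply: ler_sum => i _ /=; case: (leP c (p i)) => [c_le|_] /=; rewrite ?mulr1 ?mulr0.
Qed.

Lemma psd_spectral_proj_le (t : R) sigma : psd sigma ->
  psd (t%:C%C *: spectral_proj (fun x => x <= t) sigma
       - sigma *m spectral_proj (fun x => x <= t) sigma).
Proof.
move=> /psdP[V [q [uV -> q_ge0]]]; rewrite /spectral_proj (mx_fun_spec _ _ uV).
rewrite (mul_spec _ _ uV) -[spec V _ in X in X - _]mul1mx scalemxAl -(spec_cst t uV).
rewrite (mul_spec _ _ uV) -specB; apply: psd_spec => j /=.
by case: (leP (q j) t) => qt /=; rewrite ?mulr1 ?mulr0 ?subrr ?subr_ge0.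
Qed.

Definition threshold_test c t rho sigma :=
  range_proj (spectral_proj (fun x => c <= x) rho)
             (spectral_proj (fun x => x <= t) sigma).

Section ThresholdTest.
Variables (rho sigma : 'M[C]_m) (c t : R).
Hypotheses (rho_ge0 : psd rho) (sigma_ge0 : psd sigma).

Let Pproj := projection_spectral_proj (fun x => c <= x) rho_ge0.1.
Let Qproj := projection_spectral_proj (fun x => x <= t) sigma_ge0.1.

Lemma projection_threshold_test : projection (threshold_test c t rho sigma).
Proof. exact: projection_range_proj. Qed.

Lemma comm_threshold_test X :
  comm_mx X rho -> comm_mx X sigma -> comm_mx X (threshold_test c t rho sigma).
Proof.
move=> Xrho Xsigma; apply: comm_range_proj => //; apply: comm_mx_fun => //.
  exact: rho_ge0.1.
exact: sigma_ge0.1.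
Qed.

Lemma threshold_test_fst_error :
  retr (rho *m (1%:M - threshold_test c t rho sigma)) <=
  retr (rho *m spectral_proj (fun x => x < c) rho) +
  retr (rho *m spectral_proj (fun x => t < x) sigma).
Proof.
have -> : (fun x => x < c) = (fun x => ~~ (c <= x)) by apply/funext => x; rewrite ltNge.
have -> : (fun x => t < x) = (fun x => ~~ (x <= t)) by apply/funext => x; rewrite ltNge.
rewrite -(spectral_projC _ rho_ge0.1) -(spectral_projC _ sigma_ge0.1).
apply: range_proj_fst_error => //; apply: comm_mx_fun; first exact: rho_ge0.1.
exact: comm_mx_refl.
Qed.

Lemma threshold_test_snd_error : 0 < c -> 0 <= t ->
  retr (sigma *m threshold_test c t rho sigma) <= t / c * retr rho.
Proof.
move=> c_gt0 t_ge0.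
have sigmaQ_le := psd_spectral_proj_le t sigma_ge0.
apply: (le_trans (range_proj_snd_error Pproj Qproj t_ge0 sigmaQ_le)).
rewrite -mulrA ler_wpM2l // mulrC ler_pdivlMr // mulrC.
exact: retr_spectral_proj_ge.
Qed.

End ThresholdTest.

End RangeProjection.

(** * Tensor powers *)

Section TensorProduct.
Variable K : comNzRingType.

Lemma tensmx1 m n : (1%:M : 'M[K]_m) *t (1%:M : 'M[K]_n) = 1%:M.
Proof.
apply/matrixP => i j; case: (mxtens_indexP i) => i0 i1; case: (mxtens_indexP j) => j0 j1.
rewrite tensmxE !mxE -natrM mulnb (inj_eq (can_inj (@mxtens_indexK m n))).
by rewrite xpair_eqE.
Qed.

Lemma mxtrace_tens m n (A : 'M[K]_m) (B : 'M[K]_n) : \tr (A *t B) = \tr A * \tr B.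
Proof. by rewrite /mxtrace mulr_sum; apply: eq_bigr => i _; rewrite mxE. Qed.

Lemma tensmx_linearl m n p q (B : 'M[K]_(p, q)) : linear (fun A : 'M[K]_(m, n) => A *t B).
Proof. by move=> c A A'; apply/matrixP => i j; rewrite !mxE mulrDl mulrA. Qed.

Lemma tensmx_linearr m n p q (A : 'M[K]_(m, n)) : linear (fun B : 'M[K]_(p, q) => A *t B).
Proof. by move=> c B B'; apply/matrixP => i j; rewrite !mxE mulrDr mulrCA. Qed.

(* [ntensmx A 1 = A] and not [A *t 1%:M], whence two base cases. *)
Lemma tensor_power_ind (P : nat -> Prop) :
  P 0%N -> P 1%N -> (forall k, P k.+1 -> P k.+2) -> forall k, P k.
Proof. by move=> P0 P1 PS [//|k]; elim: k => // k; apply: PS. Qed.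

Section Families.
Variable D : nat.
Implicit Types (A B : 'M[K]_D) (Y Z : nat -> 'M[K]_D).

Fixpoint ptens_rec Y k : 'M[K]_(D ^ k.+1) :=
  if k is k'.+1 then Y 0%N *t ptens_rec (fun i => Y i.+1) k' else Y 0%N.

Definition ptens Y k : 'M[K]_(D ^ k) :=
  if k is k'.+1 then ptens_rec Y k' else 1%:M.

Lemma ptensSS Y k : ptens Y k.+2 = Y 0%N *t ptens (fun i => Y i.+1) k.+1.
Proof. by []. Qed.

Lemma ptens_cst A k : ptens (fun=> A) k = ntensmx A k.
Proof. by elim/tensor_power_ind: k => // k IHk; rewrite ptensSS IHk. Qed.

Lemma eq_ptens Y Z k : (forall i, (i < k)%N -> Y i = Z i) -> ptens Y k = ptens Z k.
Proof.
elim/tensor_power_ind: k Y Z => [//|Y Z YZ|k IHk Y Z YZ]; first exact: YZ.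
by rewrite !ptensSS YZ // (IHk _ (fun i => Z i.+1)) // => i ik; apply: YZ.
Qed.

Lemma ptensM Y Z k : ptens Y k *m ptens Z k = ptens (fun i => Y i *m Z i) k.
Proof.
elim/tensor_power_ind: k Y Z => [Y Z|//|k IHk Y Z]; first exact: mulmx1.
by rewrite !ptensSS tensmx_mul IHk.
Qed.

Lemma ptens1 k : ptens (fun=> 1%:M) k = 1%:M.
Proof. by elim/tensor_power_ind: k => // k IHk; rewrite ptensSS IHk tensmx1. Qed.

Lemma ptens_linear Z j k : (j < k)%N -> linear (fun A => ptens [eta Z with j |-> A] k).
Proof.
elim/tensor_power_ind: k Z j => [//|Z [|j] //|k IHk Z [|j] jk c A B].
  by rewrite !ptensSS; exact: tensmx_linearl.
by rewrite !ptensSS -[RHS]tensmx_linearr; congr (_ *t _); exact: (IHk (Z \o succn)).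
Qed.

Lemma ptens_single_comm A B j k : comm_mx B A ->
  comm_mx (ptens [eta (fun=> 1%:M) with j |-> B] k) (ntensmx A k).
Proof.
move=> BA; rewrite -ptens_cst /comm_mx !ptensM; apply: eq_ptens => i _ /=.
by case: eqP; rewrite ?mul1mx ?mulmx1.
Qed.

End Families.

Lemma ntensmxM D (A B : 'M[K]_D) k : ntensmx (A *m B) k = ntensmx A k *m ntensmx B k.
Proof. by rewrite -!ptens_cst ptensM. Qed.

Lemma ntens1mx D k : ntensmx (1%:M : 'M[K]_D) k = 1%:M.
Proof. by rewrite -ptens_cst ptens1. Qed.

Lemma mxtrace_ntens D (A : 'M[K]_D) k : \tr (ntensmx A k) = \tr A ^+ k.
Proof.
elim/tensor_power_ind: k => [|//|k IHk]; first by rewrite expr0; apply: mxtrace1.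
by rewrite ntensmxSS mxtrace_tens IHk -exprS.
Qed.

End TensorProduct.

Section Regrouping.
Variable K : comNzRingType.

(* On square matrices of unspecified size the tensor product is strictly
   associative. *)
Definition mxpack n (A : 'M[K]_n) : {n & 'M[K]_n} := existT _ n A.

Lemma mxpack_cast m n (eq_mn : m = n) (A : 'M[K]_m) (B : 'M[K]_n) :
  castmx (eq_mn, eq_mn) A = B -> mxpack A = mxpack B.
Proof. by case: n / eq_mn B => B; rewrite castmx_id => ->. Qed.

Lemma mxpack_eq m n (A : 'M[K]_m) (B : 'M[K]_n) :
  mxpack A = mxpack B -> exists eq_mn : m = n, castmx (eq_mn, eq_mn) A = B.
Proof.
suff cast (x y : {n & 'M[K]_n}) : x = y ->
    exists e : projT1 x = projT1 y, castmx (e, e) (projT2 x) = projT2 y by move/cast.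
by move=> ->; exists erefl; rewrite castmx_id.
Qed.

Definition pack_tens (x y : {n & 'M[K]_n}) := mxpack (projT2 x *t projT2 y).

Lemma pack_tensA : associative pack_tens.
Proof.
move=> [m A] [n B] [p E]; rewrite /pack_tens /=.
apply: (@mxpack_cast _ _ (mulnA m n p)); apply/matrixP => x y.
case: (mxtens_indexP x) => x' x2; case: (mxtens_indexP y) => y' y2.
case: (mxtens_indexP x') => x0 x1; case: (mxtens_indexP y') => y0 y1.
have cast_index (z0 : 'I_m) (z1 : 'I_n) (z2 : 'I_p) :
    cast_ord (esym (mulnA m n p)) (mxtens_index (mxtens_index (z0, z1), z2)) =
    mxtens_index (z0, mxtens_index (z1, z2)).
  by apply: val_inj; rewrite /= mulnDl mulnA addnA.
by rewrite castmxE !tensmxE !cast_index !tensmxE mulrA.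
Qed.

Lemma pack_tens1l : left_id (mxpack (1%:M : 'M[K]_1)) pack_tens.
Proof.
move=> [n A]; rewrite /pack_tens /= tens_scalar1mx; symmetry.
exact: (mxpack_cast (eq_mn := esym (mul1n n))).
Qed.

Lemma pack_tens1r : right_id (mxpack (1%:M : 'M[K]_1)) pack_tens.
Proof.
move=> [n A]; rewrite /pack_tens /= tens_mx_scalar scale1r; symmetry.
exact: (mxpack_cast (eq_mn := esym (muln1 n))).
Qed.

Lemma pack_ntensS d (A : 'M[K]_d) k :
  mxpack (ntensmx A k.+1) = pack_tens (mxpack A) (mxpack (ntensmx A k)).
Proof. by case: k => //; rewrite pack_tens1r. Qed.

Lemma pack_ntensD d (A : 'M[K]_d) m k :
  mxpack (ntensmx A (m + k)) = pack_tens (mxpack (ntensmx A m)) (mxpack (ntensmx A k)).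
Proof.
elim: m => [|m IHm]; first by rewrite pack_tens1l.
by rewrite addSn !pack_ntensS IHm pack_tensA.
Qed.

Lemma pack_ntensM d (A : 'M[K]_d) m k :
  mxpack (ntensmx (ntensmx A m) k) = mxpack (ntensmx A (m * k)).
Proof.
elim: k => [|k IHk]; first by rewrite muln0.
by rewrite pack_ntensS IHk mulnS pack_ntensD.
Qed.

Lemma ntens_blocks d m k r : exists e : ((d ^ m) ^ k * d ^ r = d ^ (m * k + r))%N,
  forall A : 'M[K]_d,
    castmx (e, e) (ntensmx (ntensmx A m) k *t ntensmx A r) = ntensmx A (m * k + r).
Proof.
have regroup (A : 'M[K]_d) :
    mxpack (ntensmx (ntensmx A m) k *t ntensmx A r) = mxpack (ntensmx A (m * k + r)).
  by rewrite pack_ntensD -pack_ntensM.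
have [e _] := mxpack_eq (regroup 0); exists e => A.
by have [e' <-] := mxpack_eq (regroup A); congr (castmx (_, _)); apply: eq_irrelevance.
Qed.

End Regrouping.

Section TensorPower.
Variable R : realType.
Local Notation C := R[i].

Lemma adj_tens m n p q (A : 'M[C]_(m, n)) (B : 'M[C]_(p, q)) :
  adj (A *t B) = adj A *t adj B.
Proof. by rewrite /adj map_mxT trmx_tens. Qed.

Lemma adj_ptens D (Y : nat -> 'M[C]_D) k : adj (ptens Y k) = ptens (fun i => adj (Y i)) k.
Proof.
elim/tensor_power_ind: k Y => [Y|//|k IHk Y]; first exact: adj_mx1.
by rewrite !ptensSS adj_tens IHk.
Qed.

Lemma adj_tpow D (A : 'M[C]_D) k : adj (tpow A k) = tpow (adj A) k.
Proof. by rewrite /tpow -!ptens_cst adj_ptens. Qed.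

Lemma tpowM D (A B : 'M[C]_D) k : tpow (A *m B) k = tpow A k *m tpow B k.
Proof. exact: ntensmxM. Qed.

Lemma unitary_tpow D (U : 'M[C]_D) k : unitary U -> unitary (tpow U k).
Proof. by move=> uU; rewrite /unitary adj_tpow -tpowM uU; exact: ntens1mx. Qed.

Lemma comm_tpow D (A B : 'M[C]_D) k : comm_mx A B -> comm_mx (tpow A k) (tpow B k).
Proof. by move=> AB; rewrite /comm_mx -!tpowM AB. Qed.

Lemma density_tpow D (A : 'M[C]_D) k : density A -> density (tpow A k).
Proof.
move=> [Apsd trA]; split; last by rewrite /tpow mxtrace_ntens trA expr1n.
by have [X ->] := psd_sqrt Apsd; rewrite tpowM -adj_tpow; apply: psd_mul_adj.
Qed.

Lemma pad_projection d m k r (T : 'M[C]_((d ^ m) ^ k)) : projection T ->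
  exists T' : 'M[C]_(d ^ (m * k + r)), [/\ projection T',
    forall A, comm_mx T (tpow (tpow A m) k) -> comm_mx T' (tpow A (m * k + r)) &
    forall A, \tr (tpow A (m * k + r) *m T') =
      \tr (tpow (tpow A m) k *m T) * \tr (tpow A r)].
Proof.
move=> [Therm TT]; have [e blocksE] := ntens_blocks R[i] d m k r.
pose F (A : 'M[C]_d) := tpow A (m * k + r).
change (exists T', [/\ projection T',
  forall A, comm_mx T (tpow (tpow A m) k) -> comm_mx T' (F A) &
  forall A, \tr (F A *m T') = \tr (tpow (tpow A m) k *m T) * \tr (tpow A r)]).
have {}blocksE A : castmx (e, e) (tpow (tpow A m) k *t tpow A r) = F A := blocksE A.
case: _ / e F blocksE => F blocksE.
exists (T *t 1%:M); split.
- by split; rewrite ?adj_tens ?Therm ?adj_mx1 // tensmx_mul TT mulmx1.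
- move=> A TA; rewrite -blocksE castmx_id /comm_mx !tensmx_mul TA.
  by rewrite mul1mx mulmx1.
- by move=> A; rewrite -blocksE castmx_id tensmx_mul mxtrace_tens mulmx1.
Qed.

End TensorPower.

Section ProductDistribution.
Variables (R : realType) (D : nat).
Local Notation C := R[i].
Implicit Types w v : 'I_D -> R.

Fixpoint word_rec k : 'I_(D ^ k.+1) -> seq 'I_D :=
  if k is k'.+1 then
    fun x : 'I_(D * D ^ k'.+1) => (mxtens_unindex x).1 :: word_rec (mxtens_unindex x).2
  else fun x => [:: x].

Definition word k : 'I_(D ^ k) -> seq 'I_D :=
  if k is k'.+1 then @word_rec k' else fun=> [::].

Lemma wordSS k (x : 'I_(D ^ k.+2)) :
  word x = (@mxtens_unindex D (D ^ k.+1) x).1 :: @word k.+1 (mxtens_unindex x).2.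
Proof. by []. Qed.

Lemma size_word k (x : 'I_(D ^ k)) : size (word x) = k.
Proof. by elim/tensor_power_ind: k x => // k IHk x; rewrite wordSS /= IHk. Qed.

Definition iid w k (x : 'I_(D ^ k)) : R := \prod_(i <- word x) w i.

Lemma iidSS w k (i : 'I_D) (x : 'I_(D ^ k.+1)) :
  @iid w k.+2 (mxtens_index (i, x)) = w i * iid w x.
Proof. by rewrite /iid wordSS mxtens_indexK big_cons. Qed.

Lemma iidM w v k (x : 'I_(D ^ k)) : iid (fun i => w i * v i) x = iid w x * iid v x.
Proof. exact: big_split. Qed.

Lemma iidV w k (x : 'I_(D ^ k)) : iid (fun i => (w i)^-1) x = (iid w x)^-1.
Proof. exact: prodfV. Qed.

Lemma iid_cst (c : R) k (x : 'I_(D ^ k)) : iid (fun=> c) x = c ^+ k.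
Proof. by rewrite /iid big_const_seq count_predT size_word -Monoid.iteropE. Qed.

Lemma iid_ge0 w k (x : 'I_(D ^ k)) : (forall i, 0 <= w i) -> 0 <= iid w x.
Proof. by move=> w_ge0; apply: prodr_ge0. Qed.

Lemma iid_powR w (s : R) k (x : 'I_(D ^ k)) : (forall i, 0 <= w i) ->
  iid (fun i => w i `^ s) x = iid w x `^ s.
Proof.
move=> w_ge0; rewrite /iid; elim: (word x) => [|i l IHl]; first by rewrite !big_nil powR1.
by rewrite !big_cons IHl powRM ?prodr_ge0.
Qed.

Lemma sum_iid w k : \sum_(x < D ^ k) iid w x = (\sum_i w i) ^+ k.
Proof.
elim/tensor_power_ind: k => [||k IHk].
- by rewrite big_ord1 /iid big_nil.
- by apply: eq_bigr => i _; rewrite /iid big_seq1.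
- by rewrite exprS -IHk mulr_sum; apply: eq_bigr => x _; rewrite /iid wordSS big_cons.
Qed.

Lemma tpow_diag (A : 'M[C]_D) w k (x : 'I_(D ^ k)) :
  (forall j, A j j = (w j)%:C%C) -> tpow A k x x = (iid w x)%:C%C.
Proof.
move=> Adiag; elim/tensor_power_ind: k x => [x|x|k IHk x].
- by rewrite /iid big_nil mxE eqxx.
- by rewrite /iid big_seq1; exact: Adiag.
- case: (mxtens_indexP x) => i j.
  by rewrite iidSS /tpow ntensmxSS tensmxE Adiag IHk rmorphM.
Qed.

Lemma tpow_rdiag w k : tpow (rdiag w) k = rdiag (@iid w k).
Proof.
apply/matrixP => x y; rewrite rdiagE; case: eqP => [<-|/eqP xy].
  by apply: tpow_diag => j; rewrite rdiagE eqxx.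
elim/tensor_power_ind: k x y xy => [x y|x y xy|k IHk x y].
- by rewrite (ord1 x) (ord1 y).
- by rewrite [LHS]rdiagE (negPf xy).
- case: (mxtens_indexP x) => i x'; case: (mxtens_indexP y) => j y'.
  rewrite (inj_eq (can_inj (@mxtens_indexK _ _))) xpair_eqE negb_and.
  rewrite /tpow ntensmxSS tensmxE.
  by case/orP => [/negPf ij|/IHk ->]; rewrite ?mulr0 // rdiagE ij mul0r.
Qed.

Lemma tpow_spec (U : 'M[C]_D) w k : tpow (spec U w) k = spec (tpow U k) (@iid w k).
Proof. by rewrite /spec !tpowM adj_tpow tpow_rdiag. Qed.

End ProductDistribution.

(** * Achievability for independent copies *)

Section Chernoff.
Variable R : realType.

Lemma expR_le_quadratic (x : R) : `|x| <= 2^-1 -> expR x <= 1 + x + 2 * x ^+ 2.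
Proof.
rewrite ler_norml => /andP[x_ge x_le]; have subx_gt0 : 0 < 1 - x by lra.
have expR_le : expR x <= (1 - x)^-1.
  by rewrite -[x in expR x]opprK expRN lef_pV2 ?posrE ?expR_gt0 // expR_ge1Dx.
apply: (le_trans expR_le); rewrite -[leLHS]mul1r ler_pdivrMr //.
have := sqr_ge0 x; nra.
Qed.

(* The moment generating function of [x] has negative derivative at [0]. *)
Lemma moment_generating_lt1 (I : finType) (w x : I -> R) :
  (forall i, 0 <= w i) -> \sum_i w i = 1 -> \sum_i w i * x i < 0 ->
  exists2 s, 0 < s & \sum_i w i * expR (s * x i) < 1.
Proof.
move=> w_ge0 w1; set mean := \sum_i _ => mean_lt0.
pose M := \sum_i `|x i|; pose V := \sum_i w i * x i ^+ 2.
have M_ge0 : 0 <= M by rewrite sumr_ge0.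
have V_ge0 : 0 <= V by rewrite sumr_ge0 // => i _; rewrite mulr_ge0 ?sqr_ge0.
pose s := Num.min (2 * (M + 1))^-1 (- mean / (4 * (V + 1))).
have s_gt0 : 0 < s by rewrite lt_min invr_gt0 divr_gt0 ?andbT; lra.
have sM_le : s * (2 * (M + 1)) <= 1 by rewrite -ler_pdivlMr ?div1r ?ge_min ?lexx //; lra.
have sV_le : s * (4 * (V + 1)) <= - mean.
  by rewrite -ler_pdivlMr ?ge_min ?lexx ?orbT //; lra.
exists s => //; apply: (@le_lt_trans _ _ (1 + s * mean + 2 * s ^+ 2 * V)); last by nra.
rewrite -{1}w1 /mean /V !mulr_sumr -!big_split; apply: ler_sum => i _ /=.
have -> : w i + s * (w i * x i) + 2 * s ^+ 2 * (w i * x i ^+ 2) =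
    w i * (1 + s * x i + 2 * (s * x i) ^+ 2) by ring.
rewrite ler_wpM2l // expR_le_quadratic // normrM (gtr0_norm s_gt0).
have : `|x i| <= M by rewrite /M (bigD1 i) //= lerDl sumr_ge0.
have := normr_ge0 (x i); nra.
Qed.

Lemma iid_tail D (w f : 'I_D -> R) (b : R) :
  (forall i, 0 <= w i) -> \sum_i w i = 1 -> (forall i, 0 <= f i) ->
  (forall i, w i != 0 -> 0 < f i) -> \sum_i w i * ln (f i) < b ->
  exists2 th, 0 <= th < 1 & forall k (B : pred 'I_(D ^ k)),
    (forall x, B x -> 0 < iid w x -> expR b ^+ k <= iid f x) ->
    \sum_(x | B x) iid w x <= th ^+ k.
Proof.
move=> w_ge0 w1 f_ge0 f_gt0 mean_lt; pose g i := f i * expR (- b).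
have g_ge0 i : 0 <= g i by rewrite mulr_ge0 ?expR_ge0.
have [|s s_gt0 mgf_lt1] := @moment_generating_lt1 _ w (fun i => ln (f i) - b) w_ge0 w1.
  by under eq_bigr do rewrite mulrBr; rewrite sumrB -mulr_suml w1 mul1r subr_lt0.
have mgfE : \sum_i w i * expR (s * (ln (f i) - b)) = \sum_i w i * g i `^ s.
  apply: eq_bigr => i _.
  have [->|/f_gt0 fi_gt0] := eqVneq (w i) 0; first by rewrite !mul0r.
  by rewrite /powR gt_eqF ?mulr_gt0 ?expR_gt0 // lnM ?posrE ?expR_gt0 // expRK.
exists (\sum_i w i * g i `^ s).
  by rewrite -mgfE mgf_lt1 sumr_ge0 // => i _; rewrite mulr_ge0 ?expR_ge0.
move=> k B f_large; rewrite -sum_iid big_mkcond; apply: ler_sum => x _.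
rewrite iidM iid_powR //; have := iid_ge0 x w_ge0.
rewrite le_eqVlt => /predU1P[w_x0|w_x_gt0].
  by rewrite -w_x0 mul0r; case: ifP.
case: ifP => [Bx|_]; last by rewrite mulr_ge0 ?powR_ge0 // ltW.
have g_ge1 : 1 <= iid g x.
  rewrite iidM iid_cst expRN exprVn ler_pdivlMr ?exprn_gt0 ?expR_gt0 // mul1r.
  exact: f_large.
rewrite ler_pMr //; have := ge0_ler_powR (ltW s_gt0) _ _ g_ge1.
by rewrite powR1; apply; rewrite nnegrE ?iid_ge0.
Qed.

End Chernoff.

Section SteinDirect.
Variable R : realType.
Local Notation C := R[i].
Variable D : nat.
Implicit Types (A rho sigma V : 'M[C]_D) (r q : 'I_D -> R).

Lemma retr_tpow_spectral_proj A V q r (b : pred R) k : unitary V ->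
  (forall j, (V *m A *m adj V) j j = (r j)%:C%C) ->
  retr (tpow A k *m spectral_proj b (tpow (spec V q) k)) =
  \sum_(x < D ^ k | b (iid q x)) iid r x.
Proof.
move=> uV Adiag; rewrite tpow_spec /spectral_proj (mx_fun_spec _ _ (unitary_tpow k uV)).
rewrite retr_mul_spec adj_tpow -!tpowM [RHS]big_mkcond; apply: eq_bigr => x _.
by rewrite (tpow_diag x Adiag) /=; case: (b _); rewrite ?mul1r ?mul0r.
Qed.

Lemma spectral_lower_tail rho (a : R) : density rho -> a < retr (rho *m mlog rho) ->
  exists2 th, 0 <= th < 1 & forall k,
    retr (tpow rho k *m spectral_proj (fun x => x < expR a ^+ k) (tpow rho k)) <= th ^+ k.
Proof.
move=> /densityP[U [p [uU -> p_ge0 p1]]]; rewrite (retr_mlog_self _ uU) => a_lt.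
have [|||th th01 tail] := @iid_tail R D p (fun i => (p i)^-1) (- a) p_ge0 p1.
- by move=> i; rewrite invr_ge0.
- by move=> i pi0; rewrite invr_gt0 lt_neqAle eq_sym pi0 p_ge0.
- suff -> : \sum_i p i * ln (p i)^-1 = - \sum_i p i * ln (p i) by rewrite ltrN2.
  rewrite -sumrN; apply: eq_bigr => i _; have := p_ge0 i; rewrite le_eqVlt.
  by case/predU1P => [<-|pi_gt0]; rewrite ?mul0r ?oppr0 // lnV ?posrE // mulrN.
exists th => // k; rewrite (retr_tpow_spectral_proj _ _ _ uU (r := p)); last first.
  by move=> j; exact: diag_conj_spec_self.
apply: tail => x p_small p_x_gt0.
by rewrite iidV expRN exprVn lef_pV2 ?posrE ?exprn_gt0 ?expR_gt0 // ltW.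
Qed.

Lemma spectral_upper_tail rho sigma (b : R) : density rho -> density sigma ->
  loewner_le (supp rho) (supp sigma) -> retr (rho *m mlog sigma) < b ->
  exists2 th, 0 <= th < 1 & forall k,
    retr (tpow rho k *m spectral_proj (fun x => expR b ^+ k < x) (tpow sigma k))
      <= th ^+ k.
Proof.
move=> /densityP[U [p [uU -> p_ge0 p1]]] /densityP[V [q [uV -> q_ge0 _]]] supp_le.
pose r j := \sum_i p i * overlap V U j i.
have r_diag j : (V *m spec U p *m adj V) j j = (r j)%:C%C by rewrite diag_conj_spec.
rewrite mlogE (mx_fun_spec _ _ uV) retr_mul_spec => b_gt.
have [|||||th th01 tail] := @iid_tail R D r q b.
- by move=> j; rewrite sumr_ge0 // => i _; rewrite mulr_ge0 ?overlap_ge0.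
- rewrite /r exchange_big -p1; apply: eq_bigr => i _.
  by rewrite -mulr_sumr sum_overlapr ?mulr1.
- exact: q_ge0.
- move=> j rj0; rewrite lt_neqAle q_ge0 andbT eq_sym; apply: contra_neq rj0 => qj0.
  rewrite /r big1 // => i _; have [->|pi0] := eqVneq (p i) 0; first by rewrite mul0r.
  by rewrite overlapC (overlap_supp uU uV supp_le) ?mulr0.
- by apply: le_lt_trans b_gt; apply: ler_sum => j _; rewrite r_diag mulrC.
exists th => // k; rewrite (retr_tpow_spectral_proj _ _ _ uV r_diag).
by apply: tail => x q_large _; exact: ltW.
Qed.

(* Cut the spectrum of [rho] just below its mean logarithm, and that of
   [sigma] just above. *)
Lemma stein_direct rho sigma (c : R) : density rho -> density sigma ->
  loewner_le (supp rho) (supp sigma) -> c < fine (relent rho sigma) ->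
  exists2 th : R, 0 <= th < 1 & forall k, exists T : 'M[C]_(D ^ k),
  [/\ projection T,
    forall X, comm_mx X (tpow rho k) -> comm_mx X (tpow sigma k) -> comm_mx X T,
    retr (tpow rho k *m (1%:M - T)) <= 2 * th ^+ k &
    retr (tpow sigma k *m T) <= expR (- (k%:R * c))].
Proof.
move=> rho_dens sigma_dens supp_le.
have between (x y : R) : c < x - y -> exists2 a, a < x & y < a - c.
  by move=> c_lt; exists ((x + y + c) / 2); lra.
rewrite (relentE supp_le) => /between[a a_lt b_gt].
have [th1 /andP[th1_ge0 th1_lt1] tail1] := spectral_lower_tail rho_dens a_lt.
have [th2 /andP[th2_ge0 th2_lt1] tail2] :=
  spectral_upper_tail rho_dens sigma_dens supp_le b_gt.
exists (Num.max th1 th2); first by rewrite le_max th1_ge0 gt_max th1_lt1 th2_lt1.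
move=> k; have [rhok_psd rhok_tr] := density_tpow k rho_dens.
have [sigmak_psd _] := density_tpow k sigma_dens.
exists (threshold_test (expR a ^+ k) (expR (a - c) ^+ k) (tpow rho k) (tpow sigma k)).
split.
- exact: projection_threshold_test.
- by move=> X; apply: comm_threshold_test.
- apply: (le_trans (threshold_test_fst_error _ _ rhok_psd sigmak_psd)).
  rewrite mulr_natl mulr2n; apply: lerD.
    by apply: (le_trans (tail1 k)); rewrite lerXn2r ?nnegrE ?le_max ?th1_ge0 ?lexx.
  by apply: (le_trans (tail2 k)); rewrite lerXn2r ?nnegrE ?le_max ?th2_ge0 ?lexx ?orbT.
- apply: (le_trans (threshold_test_snd_error rhok_psd sigmak_psd _ _)).
  + by rewrite exprn_gt0 ?expR_gt0.
  + by rewrite exprn_ge0 ?expR_ge0.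
  by rewrite /retr rhok_tr mulr1 -expr_div_n -expRB addrAC subrr sub0r -mulrN expRM_natl.
Qed.

End SteinDirect.

(** * Averaging over the group *)

Section MatrixFunctionals.
Variable K : comNzRingType.

Lemma scalar_mxtrace_mul m (T : 'M[K]_m) : scalar (fun A => \tr (A *m T)).
Proof. by move=> c A B; rewrite mulmxDl -scalemxAl mxtraceD mxtraceZ. Qed.

Lemma scalar_mulmx_entry m n p q (A : 'M[K]_(m, n)) (B : 'M[K]_(p, q)) i j :
  scalar (fun X : 'M[K]_(n, p) => (A *m X *m B) i j).
Proof. by move=> c X Y; rewrite mulmxDr mulmxDl -scalemxAr -scalemxAl !mxE. Qed.

Lemma scalar_sum_delta m n (L : 'M[K]_(m, n) -> K) : scalar L ->
  forall A, L A = \sum_ij L (delta_mx ij.1 ij.2) * A ij.1 ij.2.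
Proof.
move=> L_scalar A.
pose Ls : {scalar 'M[K]_(m, n)} := HB.pack L (GRing.isLinear.Build _ _ _ _ L L_scalar).
rewrite -[L]/(Ls : _ -> _) {1}(matrix_sum_delta A) pair_bigA linear_sum.
by apply: eq_bigr => ij _; rewrite linearZ mulrC.
Qed.

End MatrixFunctionals.

Section Continuity.
Variables (R : realType) (G : ptopologicalType).
Local Notation C := R[i].
Implicit Types f h : G -> C.

Definition ccont f : Prop :=
  continuous (fun g => complex.Re (f g) : R) /\
  continuous (fun g => complex.Im (f g) : R).

Lemma eq_ccont f h : f =1 h -> ccont f -> ccont h.
Proof. by move=> /funext ->. Qed.

Lemma ccont_cst (c : C) : ccont (fun=> c).
Proof. by split=> g; exact: cvg_cst. Qed.

Lemma ccontD f h : ccont f -> ccont h -> ccont (fun g => f g + h g).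
Proof.
move=> [fRe fIm] [hRe hIm]; split.
  rewrite (_ : (fun g => _) = (fun g => complex.Re (f g) + complex.Re (h g))).
    by move=> g; apply: cvgD; [exact: fRe|exact: hRe].
  by apply/funext => g; rewrite raddfD.
rewrite (_ : (fun g => _) = (fun g => complex.Im (f g) + complex.Im (h g))).
  by move=> g; apply: cvgD; [exact: fIm|exact: hIm].
by apply/funext => g; rewrite raddfD.
Qed.

Lemma complexReM (z w : C) :
  complex.Re (z * w) = complex.Re z * complex.Re w - complex.Im z * complex.Im w.
Proof. by case: z w => [a b] []. Qed.

Lemma complexImM (z w : C) :
  complex.Im (z * w) = complex.Re z * complex.Im w + complex.Im z * complex.Re w.
Proof. by case: z w => [a b] []. Qed.

Lemma ccontM f h : ccont f -> ccont h -> ccont (fun g => f g * h g).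
Proof.
move=> [fRe fIm] [hRe hIm]; split.
  under eq_fun do rewrite complexReM.
  by move=> g; apply: cvgB; apply: cvgM; [exact: fRe|exact: hRe|exact: fIm|exact: hIm].
under eq_fun do rewrite complexImM.
by move=> g; apply: cvgD; apply: cvgM; [exact: fRe|exact: hIm|exact: fIm|exact: hRe].
Qed.

Lemma ccont_conj f : ccont f -> ccont (fun g => Num.conj (f g)).
Proof.
have ReJ (z : C) : complex.Re (Num.conj z) = complex.Re z by case: z.
have ImJ (z : C) : complex.Im (Num.conj z) = - complex.Im z by case: z.
move=> [fRe fIm]; split; first by under eq_fun do rewrite ReJ.
by under eq_fun do rewrite ImJ; move=> g; apply: cvgN; exact: fIm.
Qed.

Lemma ccont_sum (I : Type) (s : seq I) (F : I -> G -> C) :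
  (forall i, ccont (F i)) -> ccont (fun g => \sum_(i <- s) F i g).
Proof.
move=> Fcont; elim: s => [|i s IHs].
  by apply: eq_ccont (ccont_cst 0) => g; rewrite big_nil.
by apply: eq_ccont (ccontD (Fcont i) IHs) => g; rewrite big_cons.
Qed.

Definition mcont m n (F : G -> 'M[C]_(m, n)) : Prop :=
  forall i j, ccont (fun g => F g i j).

Lemma mcont_cst m n (A : 'M[C]_(m, n)) : mcont (fun=> A).
Proof. by move=> i j; apply: ccont_cst. Qed.

Lemma mcontM m n p (F : G -> 'M[C]_(m, n)) (H : G -> 'M[C]_(n, p)) :
  mcont F -> mcont H -> mcont (fun g => F g *m H g).
Proof.
move=> Fcont Hcont i j; apply: (@eq_ccont (fun g => \sum_k F g i k * H g k j)) => [g|].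
  by rewrite mxE.
by apply: ccont_sum => k; apply: ccontM.
Qed.

Lemma mcont_adj m n (F : G -> 'M[C]_(m, n)) : mcont F -> mcont (fun g => adj (F g)).
Proof.
move=> Fcont i j; apply: (@eq_ccont (fun g => Num.conj (F g j i))) => [g|].
  by rewrite adjE.
exact: ccont_conj.
Qed.

Lemma mcont_tens m n p q (F : G -> 'M[C]_(m, n)) (H : G -> 'M[C]_(p, q)) :
  mcont F -> mcont H -> mcont (fun g => F g *t H g).
Proof.
move=> Fcont Hcont i j.
case: (mxtens_indexP i) => i0 i1; case: (mxtens_indexP j) => j0 j1.
apply: (@eq_ccont (fun g => F g i0 j0 * H g i1 j1)) => [g|]; first by rewrite tensmxE.
exact: ccontM.
Qed.

Lemma mcont_tpow d (F : G -> 'M[C]_d) k : mcont F -> mcont (fun g => tpow (F g) k).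
Proof.
move=> Fcont; elim/tensor_power_ind: k => [|//|k IHk]; first exact: mcont_cst.
exact: (mcont_tens Fcont IHk).
Qed.

End Continuity.

Section ComplexIntegral.
Variables (R : realType) (G : ptopologicalType).
Variable mu : {measure set (borel G) -> \bar R}.
Local Notation C := R[i].
Implicit Types f h : G -> C.

Definition cintegrable f : Prop :=
  mu.-integrable setT (EFin \o ((fun g => complex.Re (f g)) : borel G -> R)) /\
  mu.-integrable setT (EFin \o ((fun g => complex.Im (f g)) : borel G -> R)).

Lemma cintegrableD f h : cintegrable f -> cintegrable h ->
  cintegrable (fun g => f g + h g).
Proof.
move=> [fRe fIm] [hRe hIm]; split.
  apply: eq_integrable (integrableD measurableT fRe hRe) => // g _.
  by rewrite /= raddfD.
apply: eq_integrable (integrableD measurableT fIm hIm) => // g _.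
by rewrite /= raddfD.
Qed.

Lemma cintegralD f h : cintegrable f -> cintegrable h ->
  cintegral mu (fun g => f g + h g) = cintegral mu f + cintegral mu h.
Proof.
move=> [fRe fIm] [hRe hIm]; rewrite /cintegral.
under eq_Rintegral do rewrite raddfD.
under [X in Complex _ X]eq_Rintegral do rewrite raddfD.
by rewrite !RintegralD.
Qed.

Lemma cintegralZ (c : C) f : cintegrable f ->
  cintegral mu (fun g => c * f g) = c * cintegral mu f.
Proof.
move=> [fRe fIm]; rewrite /cintegral.
under eq_Rintegral do rewrite complexReM.
under [X in Complex _ X]eq_Rintegral do rewrite complexImM.
have scaled (a : R) (k : borel G -> R) : mu.-integrable setT (EFin \o k) ->
    mu.-integrable setT (EFin \o (fun g => a * k g)) by exact: integrableZl.
rewrite RintegralB ?RintegralD ?RintegralZl //; try exact: scaled.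
by case: c.
Qed.

Lemma cintegral_conj f : cintegrable f ->
  cintegral mu (fun g => Num.conj (f g)) = Num.conj (cintegral mu f).
Proof.
move=> [_ fIm]; rewrite /cintegral /=; congr Complex.
  by apply: eq_Rintegral => g _; case: (f g).
rewrite -mulN1r -RintegralZl //.
by apply: eq_Rintegral => g _; case: (f g) => a b /=; rewrite mulN1r.
Qed.

Lemma cintegral_ge0 f : (forall g, 0 <= f g) -> 0 <= cintegral mu f.
Proof.
move=> f_ge0; rewrite lecE /=; apply/andP; split.
  rewrite (@eq_Rintegral _ _ _ _ _ (fun=> 0)) ?Rintegral_cst ?mul0r // => g _.
  by have := f_ge0 g; rewrite lecE => /andP[/eqP->].
by apply: Rintegral_ge0 => g _; have := f_ge0 g; rewrite lecE => /andP[].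
Qed.

Lemma cintegral0 : cintegral mu (fun=> 0) = 0.
Proof. by rewrite /cintegral Rintegral_cst // mul0r. Qed.

Lemma cintegrable0 : cintegrable (fun=> 0).
Proof. by split; apply: eq_integrable (integrable0 mu setT). Qed.

Lemma cintegrable_sum (I : Type) (s : seq I) (F : I -> G -> C) :
  (forall i, cintegrable (F i)) -> cintegrable (fun g => \sum_(i <- s) F i g).
Proof.
move=> Fint; elim: s => [|i s IHs].
  by under eq_fun do rewrite big_nil; exact: cintegrable0.
by under eq_fun do rewrite big_cons; exact: cintegrableD.
Qed.

Lemma cintegral_sum (I : Type) (s : seq I) (F : I -> G -> C) :
  (forall i, cintegrable (F i)) ->
  cintegral mu (fun g => \sum_(i <- s) F i g) = \sum_(i <- s) cintegral mu (F i).
Proof.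
move=> Fint; elim: s => [|i s IHs].
  by under eq_fun do rewrite big_nil; rewrite big_nil; exact: cintegral0.
under eq_fun do rewrite big_cons; rewrite big_cons -IHs; apply: cintegralD => //.
exact: cintegrable_sum.
Qed.

End ComplexIntegral.

Section Haar.
Variables (R : realType) (G : ptopologicalType).
Variables (mul : G -> G -> G) (inv : G -> G) (one : G).
Variable mu : {measure set (borel G) -> \bar R}.
Hypothesis groupG : compact_group mul inv one.
Hypothesis haar_mu : normalized_haar mul mu.
Local Notation C := R[i].

Lemma continuous_borel (f : G -> R) :
  continuous f -> measurable_fun setT (f : borel G -> R).
Proof.
move=> /continuousP f_cont; apply: (measurability _ (RGenOpens.measurableE R)).
move=> _ [_ [a [b ->] <-]]; rewrite setTI.
by apply: sub_sigma_algebra; apply: f_cont; apply: interval_open.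
Qed.

Lemma ccont_cintegrable (f : G -> C) : ccont f -> cintegrable mu f.
Proof.
have continuous_integrable (k : G -> R) : continuous k ->
    mu.-integrable setT (EFin \o (k : borel G -> R)).
  move=> k_cont; apply: measurable_bounded_integrable => //.
  - by rewrite haar_mu.1 ltry.
  - exact: continuous_borel.
  - have G_compact : compact [set: G] by case: groupG.2.
    have k_within : {within [set: G], continuous k} by apply: continuous_subspaceT.
    have /compact_bounded[M [_ Mk]] := continuous_compact k_within G_compact.
    by exists M; split; rewrite ?num_real // => y yM x _; apply: Mk => //; exists x.
by move=> [fRe fIm]; split; apply: continuous_integrable.
Qed.

Lemma cintegral_cst (c : C) : cintegral mu (fun=> c) = c.
Proof. by rewrite /cintegral !Rintegral_cst // haar_mu.1 /= !mulr1; case: c. Qed.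

Lemma mulVK (h : G) : cancel (mul h) (mul (inv h)).
Proof. by move=> g; case: groupG => -[mulA mul1 mulV] _; rewrite mulA mulV mul1. Qed.

Lemma mulKV (h : G) : cancel (mul (inv h)) (mul h).
Proof. by move=> g; apply: (can_inj (mulVK (inv h))); rewrite mulVK. Qed.

Lemma measurable_mul (h : G) : measurable_fun setT (mul h : borel G -> borel G).
Proof.
have mul_cont : continuous (mul h).
  move=> g; have mul2_cont : continuous (fun p : G * G => mul p.1 p.2) by case: groupG.2.
  apply: (@continuous_comp _ _ _ (fun g => (h, g)) (fun p => mul p.1 p.2)).
    by apply: cvg_pair; [exact: cvg_cst|exact: cvg_id].
  exact: mul2_cont.
apply: (@measurability _ _ (borel G) (borel G) setT (mul h) (@open G)) => //.
move=> _ [A A_open <-]; rewrite setTI; apply: sub_sigma_algebra.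
by have /continuousP := mul_cont; apply.
Qed.

Lemma haar_preimage (h : G) (A : set (borel G)) :
  measurable A -> mu (mul h @^-1` A) = mu A.
Proof.
move=> A_meas; rewrite -(haar_mu.2 (inv h) A A_meas); congr (mu _).
apply/seteqP; split=> [g Ag|_ [g Ag <-]]; first by exists (mul h g) => //; exact: mulVK.
by rewrite /= mulKV.
Qed.

Lemma integral_translate (h : G) (f : borel G -> \bar R) : measurable_fun setT f ->
  (\int[mu]_g f (mul h g) = \int[mu]_g f g)%E.
Proof.
move=> f_meas.
have ge0_translate (k : borel G -> \bar R) : measurable_fun setT k ->
    (forall g, 0 <= k g)%E -> (\int[mu]_g k (mul h g) = \int[mu]_g k g)%E.
  move=> k_meas k_ge0.
  rewrite -[LHS](ge0_integral_pushforward (measurable_mul h) mu measurableT k_meas) //.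
  apply: eq_measure_integral => [|mul_meas A A_meas _]; first exact: measurable_mul.
  exact: haar_preimage.
rewrite -[LHS]/(\int[mu]_g (f \o mul h) g)%E integralE [RHS]integralE.
rewrite funepos_comp funeneg_comp; congr (_ - _)%E.
  by apply: ge0_translate => //; exact: measurable_funepos.
by apply: ge0_translate => //; exact: measurable_funeneg.
Qed.

Lemma cintegral_translate (h : G) (f : G -> C) : ccont f ->
  cintegral mu (fun g => f (mul h g)) = cintegral mu f.
Proof.
move=> [/continuous_borel/measurable_EFinP fRe /continuous_borel/measurable_EFinP fIm].
by rewrite /cintegral /Rintegral; congr (Complex (fine _) (fine _));
  [exact: (integral_translate h fRe)|exact: (integral_translate h fIm)].
Qed.

Section Average.
Variables (d : nat) (u : G -> 'M[C]_d).
Hypothesis u_rep : unitary_rep mul one u.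
Implicit Types n k : nat.

Definition rep_conj n (X : 'M[C]_(d ^ n)) g := tpow (u g) n *m X *m adj (tpow (u g) n).

Lemma mcont_rep_conj n (X : 'M[C]_(d ^ n)) : mcont (rep_conj X).
Proof.
have u_cont : mcont (fun g => tpow (u g) n).
  by apply: mcont_tpow => i j; case: u_rep => _ _ _ uRe uIm; split.
by apply: mcontM; [apply: mcontM => //; apply: mcont_cst|apply: mcont_adj].
Qed.

Lemma unitary_rep_tpow n g : unitary (tpow (u g) n).
Proof. by apply: unitary_tpow; case: u_rep. Qed.

Lemma scalar_EA n X (L : 'M[C]_(d ^ n) -> C) : scalar L ->
  L (EA mu u X) = cintegral mu (fun g => L (rep_conj X g)).
Proof.
move=> L_scalar; have L_sum := scalar_sum_delta L_scalar.
have entry_int ij :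
    cintegrable mu (fun g => L (delta_mx ij.1 ij.2) * rep_conj X g ij.1 ij.2).
  by apply/ccont_cintegrable/ccontM; [exact: ccont_cst|exact: mcont_rep_conj].
under eq_fun do rewrite L_sum; rewrite cintegral_sum // L_sum; apply: eq_bigr => ij _.
rewrite cintegralZ; last exact/ccont_cintegrable/mcont_rep_conj.
by rewrite mxE.
Qed.

Lemma scalar_EA_invariant n X (L : 'M[C]_(d ^ n) -> C) : scalar L ->
  (forall g, L (rep_conj X g) = L X) -> L (EA mu u X) = L X.
Proof.
move=> L_scalar L_inv; rewrite scalar_EA //; under eq_fun do rewrite L_inv.
exact: cintegral_cst.
Qed.

Lemma mxtrace_EA_mul n (X T : 'M[C]_(d ^ n)) : in_An u T ->
  \tr (EA mu u X *m T) = \tr (X *m T).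
Proof.
move=> T_inv; apply: (scalar_EA_invariant (scalar_mxtrace_mul T)) => g.
exact: mxtrace_conj_comm (unitary_rep_tpow n g) (T_inv g).
Qed.

Lemma psd_EA n (X : 'M[C]_(d ^ n)) : psd X -> psd (EA mu u X).
Proof.
move=> [Xherm Xpos]; split=> [|v].
  apply/matrixP => i j; rewrite adjE [in LHS]mxE -cintegral_conj; last first.
    exact/ccont_cintegrable/mcont_rep_conj.
  rewrite mxE; congr cintegral; apply/funext => g.
  by rewrite -adjE !adjM adjK Xherm mulmxA.
rewrite (scalar_EA X (scalar_mulmx_entry v (adj v) 0 0)); apply: cintegral_ge0 => g.
by have := Xpos (v *m tpow (u g) n); rewrite adjM !mulmxA.
Qed.

Lemma density_EA n (X : 'M[C]_(d ^ n)) : density X -> density (EA mu u X).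
Proof.
move=> [Xpsd trX]; split; first exact: psd_EA.
rewrite -[EA _ _ _]mulmx1 mxtrace_EA_mul ?mulmx1 //.
by move=> g; exact: comm1mx.
Qed.

Lemma EA_in_An n (X : 'M[C]_(d ^ n)) : in_An u (EA mu u X).
Proof.
move=> h; set U := tpow (u h) n; have uU : unitary U := unitary_rep_tpow n h.
suff EA_conj : U *m EA mu u X *m adj U = EA mu u X.
  by rewrite -{1}EA_conj (mulmx_unitaryVK _ uU).
apply/matrixP => i j; rewrite (scalar_EA X (scalar_mulmx_entry U (adj U) i j)) [RHS]mxE.
rewrite -(cintegral_translate h (mcont_rep_conj X i j)).
congr cintegral; apply/funext => g.
by case: u_rep => u_mul _ _ _ _; rewrite /rep_conj u_mul tpowM adjM !mulmxA.
Qed.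

Lemma mxtrace_ptens_EA n k j (Z : nat -> 'M[C]_(d ^ n)) X (T : 'M[C]_((d ^ n) ^ k)) :
  (j < k)%N ->
  (forall g, comm_mx T (ptens [eta (fun=> 1%:M) with j |-> tpow (u g) n] k)) ->
  \tr (ptens [eta Z with j |-> EA mu u X] k *m T) =
  \tr (ptens [eta Z with j |-> X] k *m T).
Proof.
move=> jk T_comm.
pose L A := \tr (ptens [eta Z with j |-> A] k *m T).
apply: (@scalar_EA_invariant n X L) => [c A B|g]; rewrite /L.
  by rewrite ptens_linear // scalar_mxtrace_mul.
pose V := ptens [eta (fun=> 1%:M) with j |-> tpow (u g) n] k.
have adjV : adj V = ptens [eta (fun=> 1%:M) with j |-> adj (tpow (u g) n)] k.
  by rewrite adj_ptens; apply: eq_ptens => i _ /=; case: eqP => // _; exact: adj_mx1.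
have uV : unitary V.
  rewrite /unitary adjV ptensM -[RHS](@ptens1 _ (d ^ n) k); apply: eq_ptens => i _ /=.
  by case: eqP => _; [exact: unitary_rep_tpow|exact: mulmx1].
rewrite -[RHS](mxtrace_conj_comm _ uV (T_comm g)) adjV !ptensM; congr (\tr (_ *m _)).
by apply: eq_ptens => i _ /=; case: eqP => // _; rewrite mul1mx mulmx1.
Qed.

Lemma mxtrace_tpow_EA n k (X : 'M[C]_(d ^ n)) (T : 'M[C]_((d ^ n) ^ k)) :
  (forall j g, comm_mx T (ptens [eta (fun=> 1%:M) with j |-> tpow (u g) n] k)) ->
  \tr (tpow (EA mu u X) k *m T) = \tr (tpow X k *m T).
Proof.
move=> T_comm; pose Z l i := if (i < l)%N then EA mu u X else X.
suff step l : (l <= k)%N -> \tr (ptens (Z l) k *m T) = \tr (tpow X k *m T).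
  rewrite -(step k) // /tpow -ptens_cst; congr (\tr (_ *m _)).
  by apply: eq_ptens => i ik; rewrite /Z ik.
elim: l => [_|l IHl lk]; first by rewrite /tpow -ptens_cst.
rewrite -IHl ?(ltnW lk) //.
have -> : ptens (Z l.+1) k = ptens [eta Z l with l |-> EA mu u X] k.
  by apply: eq_ptens => i _; rewrite /Z /= ltnS leq_eqVlt; case: eqP.
have -> : ptens (Z l) k = ptens [eta Z l with l |-> X] k.
  by apply: eq_ptens => i _; rewrite /Z /=; case: eqP => [->|//]; rewrite ltnn.
exact: mxtrace_ptens_EA.
Qed.

End Average.
End Haar.

(** * Error exponents *)

Section Limits.
Variable R : realType.
Implicit Types (x y l : \bar R) (v : (\bar R)^nat).

Lemma lee_of_fin_lt x y : (forall t : R, (t%:E < x)%E -> (t%:E <= y)%E) -> (x <= y)%E.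
Proof.
move=> below; rewrite leNgt; apply/negP; case: x y below => [x| |] [y| |] below //=.
- rewrite lte_fin => yx; have := below ((x + y) / 2); rewrite lte_fin lee_fin.
  by move=> /(_ ltac:(lra)); lra.
- by move=> _; have := below (x - 1); rewrite lte_fin => /(_ ltac:(lra)).
- by move=> _; have := below (y + 1); rewrite ltry lee_fin => /(_ isT); lra.
- by move=> _; have := below 0; rewrite ltry => /(_ isT).
Qed.

Lemma near_limn_einf_ge v l : (\forall n \near \oo, (l <= v n)%E) -> (l <= limn_einf v)%E.
Proof.
move=> v_ge; rewrite /limn_einf leeNr.
apply: (@le_trans _ _ (ereal_sup ((\- v)%E @` [set n | (l <= v n)%E]))).
  by apply: ereal_inf_lbound; exists [set n | (l <= v n)%E].
by apply: ge_ereal_sup => _ [n vn_ge <-]; rewrite leeN2.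
Qed.

Lemma cvg_ereal_sup v : (forall t : R, (t%:E < ereal_sup (range v))%E ->
    \forall n \near \oo, (t%:E <= v n)%E) ->
  v @ \oo --> ereal_sup (range v).
Proof.
move=> v_ge; suff : (-%E \o v) @ \oo --> (- ereal_sup (range v))%E.
  by move=> /cvgeN; rewrite oppeK; under eq_fun do rewrite /= oppeK.
apply: limn_esup_le_cvg => [|n]; last by rewrite leeN2; apply: ereal_sup_ubound; exists n.
by rewrite limn_esupN leeN2; apply: lee_of_fin_lt => t /v_ge; apply: near_limn_einf_ge.
Qed.

Lemma near_expRN_le (c delta : R) : 0 < c -> 0 < delta ->
  \forall n \near \oo, expR (- (n%:R * delta)) <= c.
Proof.
move=> c_gt0 delta_gt0; apply: filterS (nbhs_infty_ger (c * delta)^-1) => n n_ge.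
rewrite expRN invf_ple ?posrE ?expR_gt0 //; apply: le_trans (expR_ge1Dx _).
have : c^-1 <= n%:R * delta by rewrite -ler_pdivrMr // -invfM.
lra.
Qed.

Lemma near_mul_divn_le (b c : R) m : (0 < m)%N -> 0 <= b -> m%:R * b < c ->
  \forall n \near \oo, n%:R * b <= (n %/ m)%:R * c.
Proof.
move=> m_gt0 b_ge0 mb_lt; have m_gt0R : 0 < m%:R :> R by rewrite ltr0n.
have mb_ge0 : 0 <= m%:R * b by rewrite mulr_ge0.
apply: filterS (nbhs_infty_ger (m%:R * c / (c - m%:R * b))) => n.
rewrite ler_pdivrMr ?subr_gt0 // => n_ge.
have n_le : n%:R <= ((n %/ m)%:R + 1) * m%:R :> R.
  by rewrite natr1 -natrM ler_nat ltnW // ltn_ceil.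
rewrite -(ler_pM2l m_gt0R); nra.
Qed.

End Limits.

Section HypothesisTesting.
Variables (R : realType) (G : ptopologicalType).
Variables (mul : G -> G -> G) (inv : G -> G) (one : G).
Variable mu : {measure set (borel G) -> \bar R}.
Local Notation C := R[i].
Variables (d : nat) (u : G -> 'M[C]_d) (rho0 rho1 : 'M[C]_d).

Definition avg_relent n : R := fine (relent (rho_n mu u rho0 n) (rho_n mu u rho1 n)).
(* The term of index [0] is [0^-1 * _ = 0]. *)
Definition relent_rate n : R := (n%:R)^-1 * avg_relent n.
Definition sup_relent_rate : \bar R := ereal_sup (range (EFin \o relent_rate)).

Lemma sup_relent_rate_ge0 : (0 <= sup_relent_rate)%E.
Proof.
by apply: ereal_sup_ubound; exists 0%N => //=; rewrite /relent_rate invr0 mul0r.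
Qed.

Lemma relent_rate_le_sup n : ((relent_rate n)%:E <= sup_relent_rate)%E.
Proof. by apply: ereal_sup_ubound; exists n. Qed.

Lemma lt_sup_relent_rate (t : R) : 0 <= t -> (t%:E < sup_relent_rate)%E ->
  exists2 m, (0 < m)%N & m%:R * t < avg_relent m.
Proof.
move=> t_ge0 /ereal_sup_gt[_ [m _ <-]]; rewrite lte_fin /relent_rate => t_lt.
have m_gt0 : (0 < m)%N.
  by case: m t_lt => //; rewrite invr0 mul0r ltNge t_ge0.
by exists m => //; rewrite -ltr_pdivlMl // ltr0n.
Qed.

Lemma in_An1 n : in_An u (1%:M : 'M[C]_(d ^ n)).
Proof. by move=> g; exact: comm1mx. Qed.

Lemma in_AnB n (A B : 'M[C]_(d ^ n)) : in_An u A -> in_An u B -> in_An u (A - B).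
Proof. by move=> A_inv B_inv g; apply/comm_mx_sym/comm_mxB; apply/comm_mx_sym. Qed.

Lemma in_AnZ n (c : C) (A : 'M[C]_(d ^ n)) : in_An u A -> in_An u (c *: A).
Proof. by move=> A_inv g; rewrite -scalemxAl -scalemxAr A_inv. Qed.

Lemma rateE T n : 0 < beta1 rho1 (T n) ->
  rate rho1 T n = ((n%:R)^-1 * ln (beta1 rho1 (T n)))%:E.
Proof. by rewrite /rate /elog => ->; rewrite EFinM. Qed.

Lemma s_lower_le_upper : (s_lower u rho0 rho1 <= s_upper u rho0 rho1)%E.
Proof.
apply: le_ereal_inf_tmp => _ [T [T_adm ->]]; apply: le_trans (limn_einf_sup _).
by apply: ereal_inf_lbound; exists T.
Qed.

Lemma s_upper_le_lim : (s_upper u rho0 rho1 <= s_lim u rho0 rho1)%E.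
Proof.
apply: le_ereal_inf_tmp => l [T [T_adm l_lim]]; apply: ereal_inf_lbound.
by exists T; split=> //; rewrite (cvg_limn_einf_sup l_lim).2.
Qed.

Section Densities.
Hypotheses (rho0_dens : density rho0) (rho1_dens : density rho1).

Lemma retr_tpow_compl rho n (T : 'M[C]_(d ^ n)) : density rho ->
  retr (tpow rho n *m (1%:M - T)) = 1 - retr (tpow rho n *m T).
Proof. by move=> /(density_tpow n)[_ tr1]; rewrite mulmxBr mulmx1 retrB /retr tr1. Qed.

Lemma beta0_ge0 n (T : 'M[C]_(d ^ n)) : effect T -> 0 <= beta0 rho0 T.
Proof.
move=> Teff; apply: retr_mul_ge0 (effectC Teff).1.
by case: (density_tpow n rho0_dens).
Qed.

(* Mix [T] with the identity. *)
Lemma raise_beta1 n (T : 'M[C]_(d ^ n)) (b : R) :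
  effect T -> in_An u T -> beta1 rho1 T <= b -> b < 1 ->
  exists T' : 'M[C]_(d ^ n), [/\ effect T', in_An u T',
    beta0 rho0 T' <= beta0 rho0 T & beta1 rho1 T' = b].
Proof.
move=> Teff T_inv beta1_le b_lt1; set beta := beta1 rho1 T in beta1_le *.
have beta_lt1 : 0 < 1 - beta by rewrite subr_gt0 (le_lt_trans beta1_le).
pose c := (b - beta) / (1 - beta).
have c01 : 0 <= c <= 1.
  apply/andP; split; first by rewrite divr_ge0 ?subr_ge0 // -subr_ge0 ltW.
  by rewrite ler_pdivrMr // mul1r lerD2r ltW.
have compl : 1%:M - (1%:M - (1 - c)%:C%C *: (1%:M - T)) = (1 - c)%:C%C *: (1%:M - T).
  by rewrite opprB addrC subrK.
exists (1%:M - (1 - c)%:C%C *: (1%:M - T)); split.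
- exact: effect_mix.
- by apply/in_AnB/in_AnZ/in_AnB => //; exact: in_An1.
- rewrite /beta0 compl -scalemxAr -/(retr _) retrZ; apply: ler_piMl.
    exact: beta0_ge0.
  by case/andP: c01; lra.
- rewrite /beta1 -/(retr _) retr_tpow_compl // -scalemxAr retrZ retr_tpow_compl //.
  by rewrite -[retr _]/beta /c; field; rewrite gt_eqF.
Qed.

Lemma s_lim_le0 : (s_lim u rho0 rho1 <= 0)%E.
Proof.
apply: ereal_inf_lbound; exists (fun n => 1%:M); split; [split|].
- by move=> n; split; [exact: in_An1|apply/loewner_effectP/projection_effect/projection1].
- rewrite (_ : (fun n => _) = cst 0); first exact: cvg_cst.
  by apply/funext => n; rewrite /beta0 subrr mulmx0 mxtrace0.
- rewrite (_ : rate _ _ = cst 0%E); first exact: cvg_cst.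
  apply/funext => n; have beta1_1 : beta1 rho1 (1%:M : 'M[C]_(d ^ n)) = 1.
    by rewrite /beta1 mulmx1; have [_ ->] := density_tpow n rho1_dens.
  by rewrite rateE beta1_1 // ln1 mulr0.
Qed.

Section Symmetry.
Hypotheses (groupG : compact_group mul inv one) (haar_mu : normalized_haar mul mu).
Hypothesis u_rep : unitary_rep mul one u.
Hypothesis supp_le : forall n : nat,
  loewner_le (supp (rho_n mu u rho0 n)) (supp (rho_n mu u rho1 n)).

Lemma density_rho_n rho n : density rho -> density (rho_n mu u rho n).
Proof.
by move=> rho_dens; apply: (density_EA groupG haar_mu u_rep); apply: density_tpow.
Qed.

Lemma relent_rate_ge0 n : 0 <= relent_rate n.
Proof.
rewrite mulr_ge0 ?invr_ge0 //.
by apply: relent_ge0; [exact: density_rho_n|exact: density_rho_n|exact: supp_le].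
Qed.

Lemma retr_rho_n_mul rho n (T : 'M[C]_(d ^ n)) : in_An u T ->
  retr (rho_n mu u rho n *m T) = retr (tpow rho n *m T).
Proof. by move=> T_inv; rewrite /retr (mxtrace_EA_mul groupG haar_mu u_rep). Qed.

Lemma block_test m (c : R) : c < avg_relent m -> exists2 th : R, 0 <= th < 1 &
  forall k r, exists T : 'M[C]_(d ^ (m * k + r)),
  [/\ effect T, in_An u T, beta0 rho0 T <= 2 * th ^+ k &
      beta1 rho1 T <= expR (- (k%:R * c))].
Proof.
move=> c_lt; have rho_m_dens := density_rho_n m.
have [th th01 test] := stein_direct (rho_m_dens _ rho0_dens) (rho_m_dens _ rho1_dens)
  (supp_le m) c_lt.
exists th => // k r; have [T [Tproj T_comm err0 err1]] := test k.
have rho_m_comm rho g : comm_mx (tpow (u g) m) (rho_n mu u rho m).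
  by apply/comm_mx_sym; exact: (EA_in_An groupG haar_mu u_rep).
have T_local j g : comm_mx T (ptens [eta (fun=> 1%:M) with j |-> tpow (u g) m] k).
  by apply/comm_mx_sym/T_comm; apply: ptens_single_comm.
have T_avg rho : retr (tpow (rho_n mu u rho m) k *m T) = retr (tpow (tpow rho m) k *m T).
  by rewrite /retr (mxtrace_tpow_EA groupG haar_mu u_rep).
have [T' [T'proj T'_comm T'_tr]] := pad_projection r Tproj.
have T'_retr rho : density rho ->
    retr (tpow rho (m * k + r) *m T') = retr (tpow (rho_n mu u rho m) k *m T).
  move=> rho_dens; rewrite T_avg /retr T'_tr.
  by have [_ ->] := density_tpow r rho_dens; rewrite mulr1.
exists T'; split; first exact: projection_effect.
- by move=> g; apply: T'_comm; apply/comm_mx_sym/T_comm; apply: comm_tpow.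
- rewrite /beta0 -/(retr _) retr_tpow_compl // T'_retr //.
  have [_ tr1] := density_tpow k (rho_m_dens _ rho0_dens).
  by move: err0; rewrite mulmxBr mulmx1 retrB /retr tr1.
- by rewrite /beta1 -/(retr _) T'_retr.
Qed.

Lemma exact_block_test m (b c : R) : 0 < b -> c < avg_relent m ->
  exists2 th : R, 0 <= th < 1 & forall n, exists T : 'M[C]_(d ^ n),
  [/\ effect T, in_An u T, beta0 rho0 T <= 2 * th ^+ (n %/ m) &
    n%:R * b <= (n %/ m)%:R * c -> (0 < n)%N -> beta1 rho1 T = expR (- (n%:R * b))].
Proof.
move=> b_gt0 /block_test[th th01 test]; exists th => // n.
have [T [Teff T_inv err0 err1]] : exists T : 'M[C]_(d ^ n), [/\ effect T, in_An u T,
    beta0 rho0 T <= 2 * th ^+ (n %/ m) & beta1 rho1 T <= expR (- ((n %/ m)%:R * c))].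
  by have := test (n %/ m)%N (n %% m)%N; rewrite mulnC -divn_eq.
have [/andP[nb_le n_gt0]|small] := boolP ((n%:R * b <= (n %/ m)%:R * c) && (0 < n)%N).
  have beta1_le : beta1 rho1 T <= expR (- (n%:R * b)).
    by apply: (le_trans err1); rewrite ler_expR lerN2.
  have lt1 : expR (- (n%:R * b)) < 1 by rewrite expR_lt1 oppr_lt0 mulr_gt0 // ltr0n.
  have [T' [T'eff T'_inv beta0_le beta1E]] := raise_beta1 Teff T_inv beta1_le lt1.
  exists T'; split; [exact: T'eff|exact: T'_inv|exact: le_trans err0|by []].
by exists T; split=> // nb_le n_gt0; rewrite nb_le n_gt0 in small.
Qed.

Lemma exact_rate_test m (b : R) : (0 < m)%N -> 0 < b -> m%:R * b < avg_relent m ->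
  exists T, admissible u rho0 T /\
    \forall n \near \oo, beta1 rho1 (T n) = expR (- (n%:R * b)).
Proof.
move=> m_gt0 b_gt0 mb_lt.
have [c mb_lt_c c_lt] : exists2 c, m%:R * b < c & c < avg_relent m.
  by exists ((m%:R * b + avg_relent m) / 2); lra.
have [th /andP[th_ge0 th_lt1] test] := exact_block_test b_gt0 c_lt.
pose T n := projT1 (cid (test n)); have T_spec n := projT2 (cid (test n)).
exists T; split; [split|].
- by move=> n; have [Teff T_inv _ _] := T_spec n; split; last exact/loewner_effectP.
- apply: (@squeeze_cvgr _ _ _ _ (cst 0) (fun n => 2 * th ^+ (n %/ m)%N)).
  + by apply: nearW => n; have [Teff _ err0 _] := T_spec n; rewrite err0 beta0_ge0.
  + exact: cvg_cst.
  + rewrite -[X in _ --> X](mulr0 2); apply: cvgM; first exact: cvg_cst.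
    apply: (@cvg_comp _ _ _ (fun n => (n %/ m)%N) (fun k => th ^+ k)).
      exact: cvg_divnr.
    by apply: cvg_expr; rewrite ger0_norm.
- have nb_le_near := near_mul_divn_le m_gt0 (ltW b_gt0) mb_lt_c.
  apply: filterS2 nb_le_near (nbhs_infty_gt 0) => n nb_le n_gt0.
  by have [_ _ _] := T_spec n; apply.
Qed.

Lemma near_beta1_ge T (s e : R) : admissible u rho0 T -> 0 <= s -> 0 < e ->
  \forall n \near \oo,
    avg_relent n <= n%:R * s -> expR (- (n%:R * (s + e))) <= beta1 rho1 (T n).
Proof.
move=> [T_test beta0_cvg] s_ge0 e_gt0; pose delta := e / 2.
have delta_gt0 : 0 < delta by rewrite /delta; lra.
have sum_gt0 : 0 < s + delta by lra.
pose c := delta / (2 * (s + delta)); have c_gt0 : 0 < c by rewrite divr_gt0 //; lra.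
have beta0_small : \forall n \near \oo, beta0 rho0 (T n) <= c / 4.
  have /cvgrPdist_le/(_ (c / 4)) := beta0_cvg; rewrite divr_gt0 // => /(_ isT).
  by apply: filterS => n; rewrite sub0r normrN; apply: le_trans; exact: ler_norm.
have expR_small : \forall n \near \oo, expR (- (n%:R * delta)) <= c / 4.
  by apply: near_expRN_le => //; rewrite divr_gt0.
apply: filterS3 beta0_small expR_small (nbhs_infty_ger (2 / delta)) => n err0 expR_le.
rewrite ler_pdivrMr // => n_delta_ge2 relent_le.
have n_gt0 : 0 < n%:R :> R by rewrite -(pmulr_lgt0 _ delta_gt0); lra.
have [T_inv /loewner_effectP Teff] := T_test n.
pose a := n%:R * (s + delta); have a_gt0 : 0 < a by rewrite mulr_gt0.
have ac : a * (1 - c) = n%:R * s + n%:R * delta / 2.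
  by rewrite /a /c; field; rewrite gt_eqF.
have -> : expR (- (n%:R * (s + e))) = expR (- (n%:R * delta)) * expR (- a).
  by rewrite -expRD /a /delta; congr expR; field.
apply: (le_trans (ler_wpM2r (expR_ge0 _) expR_le)).
rewrite /beta1 -/(retr _) -(retr_rho_n_mul rho1 T_inv).
have rho_n_dens := density_rho_n n.
apply: (second_error_ge (rho_n_dens _ rho0_dens) (rho_n_dens _ rho1_dens) (supp_le n)) => //.
  by rewrite ac -/(avg_relent n); lra.
by rewrite retr_rho_n_mul //; apply: in_AnB => //; exact: in_An1.
Qed.

(* At an [n] of rate below [t], the converse bound would forbid the test of
   exponent [b > t]. *)
Lemma near_relent_rate_ge (t : R) : (t%:E < sup_relent_rate)%E ->
  \forall n \near \oo, t <= relent_rate n.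
Proof.
have [t_lt0 _|t_ge0 t_lt] := ltP t 0.
  by apply: nearW => n; apply: le_trans (relent_rate_ge0 n); exact: ltW.
have [m m_gt0 mt_lt] := lt_sup_relent_rate t_ge0 t_lt.
have m_gt0R : 0 < m%:R :> R by rewrite ltr0n.
have [b t_lt_b mb_lt] : exists2 b, t < b & m%:R * b < avg_relent m.
  move: mt_lt; rewrite mulrC -ltr_pdivlMr // => t_lt_rate.
  exists ((t + avg_relent m / m%:R) / 2); first lra.
  by rewrite mulrC -ltr_pdivlMr //; lra.
have [T [T_adm beta1E]] := exact_rate_test m_gt0 (le_lt_trans t_ge0 t_lt_b) mb_lt.
have e_gt0 : 0 < (b - t) / 2 by lra.
apply: filterS3 beta1E (near_beta1_ge T_adm t_ge0 e_gt0) (nbhs_infty_gt 0).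
move=> n -> converse n_gt0.
rewrite /relent_rate ler_pdivlMl ?ltr0n // leNgt; apply/negP => /ltW/converse.
by rewrite ler_expR lerN2 ler_pM2l ?ltr0n //; lra.
Qed.

Lemma S_M_sup : S_M mu u rho0 rho1 = sup_relent_rate.
Proof.
rewrite /S_M (_ : (fun n => _) = EFin \o relent_rate); last first.
  by apply/funext => n; rewrite /= EFinM fine_relentK.
by apply/cvg_lim => //; apply: cvg_ereal_sup => t; exact: near_relent_rate_ge.
Qed.

Lemma s_lim_le_S_M : (s_lim u rho0 rho1 <= - S_M mu u rho0 rho1)%E.
Proof.
rewrite S_M_sup leeNr; apply: lee_of_fin_lt => t t_lt; rewrite leeNr -EFinN.
have [t_le0|t_gt0] := leP t 0.
  by apply: (le_trans s_lim_le0); rewrite lee_fin oppr_ge0.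
have [m m_gt0 mt_lt] := lt_sup_relent_rate (ltW t_gt0) t_lt.
have [T [T_adm beta1E]] := exact_rate_test m_gt0 t_gt0 mt_lt.
apply: ereal_inf_lbound; exists T; split=> //; apply: cvg_near_cst.
apply: filterS2 beta1E (nbhs_infty_gt 0) => n beta1E n_gt0.
by rewrite rateE beta1E ?expR_gt0 // expRK -mulrN mulKf // pnatr_eq0 -lt0n.
Qed.

Lemma s_lower_ge_S_M : (- S_M mu u rho0 rho1 <= s_lower u rho0 rho1)%E.
Proof.
rewrite S_M_sup; apply: le_ereal_inf_tmp => _ [T [T_adm ->]].
apply: lee_of_fin_lt => t; rewrite lteNr -EFinN => t_gt.
have [s supE] : exists s, sup_relent_rate = s%:E.
  exists (fine sup_relent_rate); rewrite fineK // ge0_fin_numE ?sup_relent_rate_ge0 //.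
  by rewrite (lt_trans t_gt) // ltry.
have s_ge0 : 0 <= s by rewrite -lee_fin -supE; exact: sup_relent_rate_ge0.
rewrite supE lte_fin in t_gt.
have e_gt0 : 0 < - t - s by lra.
apply: near_limn_einf_ge.
apply: filterS2 (near_beta1_ge T_adm s_ge0 e_gt0) (nbhs_infty_gt 0) => n converse n_gt0.
have n_gt0R : 0 < n%:R :> R by rewrite ltr0n.
have := relent_rate_le_sup n; rewrite supE lee_fin /relent_rate ler_pdivrMl //.
move=> /converse; rewrite subrKC mulrN opprK => beta1_ge.
have beta1_gt0 : 0 < beta1 rho1 (T n) by apply: lt_le_trans beta1_ge; exact: expR_gt0.
rewrite rateE // lee_fin ler_pdivlMl // -[leLHS]expRK ler_ln // posrE; exact: expR_gt0.
Qed.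

End Symmetry.
End Densities.
End HypothesisTesting.

Theorem theorem4p4 (R : realType) (G : ptopologicalType)
  (mul : G -> G -> G) (inv : G -> G) (one : G)
  (mu : {measure set (borel G) -> \bar R})
  (d : nat) (u : G -> 'M[R[i]]_d) (rho0 rho1 : 'M[R[i]]_d) :
  compact_group mul inv one ->
  normalized_haar mul mu ->
  unitary_rep mul one u ->
  density rho0 -> density rho1 ->
  (forall n : nat, loewner_le (supp (rho_n mu u rho0 n)) (supp (rho_n mu u rho1 n))) ->
  s_lower u rho0 rho1 = s_upper u rho0 rho1 /\
  s_upper u rho0 rho1 = s_lim u rho0 rho1 /\
  s_lim u rho0 rho1 = (- S_M mu u rho0 rho1)%E.
Proof.
move=> groupG haar_mu u_rep rho0_dens rho1_dens supp_le.
have lim_le := s_lim_le_S_M rho0_dens rho1_dens groupG haar_mu u_rep supp_le.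
have lower_ge := s_lower_ge_S_M rho0_dens rho1_dens groupG haar_mu u_rep supp_le.
have lower_le_upper := s_lower_le_upper u rho0 rho1.
have upper_le_lim := s_upper_le_lim u rho0 rho1.
split; [|split]; apply/eqP; rewrite eq_le.
- by rewrite lower_le_upper (le_trans upper_le_lim) ?(le_trans lim_le).
- by rewrite upper_le_lim (le_trans lim_le) ?(le_trans lower_ge).
- by rewrite lim_le (le_trans lower_ge) ?(le_trans lower_le_upper).
Qed.
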